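(* Let $k\ge 3$, $n=k+1$, and reals $s_1,\dots,s_{k-1}$. For any $a,b\in S_k$ with $a\succ_k b$ there is a continuous function $p:[0,1]\to S_k$ with $p(0)=b$, $p(1)=a$, and $p(t_1)\succ_k p(t_0)$ whenever $t_1\ge t_0$.
   Context: $S_k:=\{(x_1,\dots,x_n)\in\mathbb{R}^n : x_1\ge\cdots\ge x_n,\ \sum_{i=1}^n x_i^j=s_j\text{ for }j=1,\dots,k-1\}$ with the subspace topology from $\mathbb{R}^n$. For $a,b\in\mathbb{R}^n$, $a\succ_k b$ means $\sum_{i=1}^n f(a_i)\ge\sum_{i=1}^n f(b_i)$ for every $k$ times differentiable $f:\mathbb{R}\to\mathbb{R}$ with $f^{(k)}\ge 0$. *)

(* Defs.v *)
From Stdlib Require Import Reals Lra Lia.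
Open Scope R_scope.

(* Points of R^n are represented as x : nat -> R, only the coordinates
   x 0, ..., x (n-1) being relevant (x_{i+1} in the paper is x i here). *)

Fixpoint rsum (n : nat) (F : nat -> R) : R :=
  match n with
  | O => 0
  | S m => rsum m F + F m
  end.

Definition in_S (k n : nat) (s : nat -> R) (x : nat -> R) : Prop :=
  (forall i : nat, (i + 1 < n)%nat -> x (i + 1)%nat <= x i) /\
  (forall j : nat, (1 <= j)%nat -> (j <= k - 1)%nat -> rsum n (fun i => x i ^ j) = s j).

Definition k_diff_nonneg (k : nat) (f : R -> R) : Prop :=
  exists g : nat -> R -> R,
    (forall x, g O x = f x) /\
    (forall j : nat, (j < k)%nat -> forall x, derivable_pt_lim (g j) x (g (S j) x)) /\
    (forall x, 0 <= g k x).

Definition kmaj (k n : nat) (a b : nat -> R) : Prop :=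
  forall f : R -> R, k_diff_nonneg k f ->
    rsum n (fun i => f (a i)) >= rsum n (fun i => f (b i)).

Definition cont_on_01 (h : R -> R) : Prop :=
  forall t, 0 <= t <= 1 -> forall eps, eps > 0 ->
    exists delta, delta > 0 /\
      forall t', 0 <= t' <= 1 -> Rabs (t' - t) < delta -> Rabs (h t' - h t) < eps.

(* Main.v *)
Require Import Defs.
From Stdlib Require Import Reals.
From mathcomp Require all_boot all_order all_algebra polyrcf ring lra zify.
From mathcomp Require all_classical all_reals all_analysis Rstruct Rstruct_topology.

(** Identify a point [x] with the real-rooted polynomial [P_x = prod_i (X - x_i)].
    By Newton's identities the difference of two polynomials of [S_k] is affine,
    with linear coefficient proportional to the difference of the k-th power sums.
    Order [S_k] by the largest coordinate together with (-1)^(k+1) times the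
    smallest one; k-majorization implies this order (test it on exponentials).

    If [r] is a root of [P] and [P - d (X - r)], [d > 0], is again real-rooted,
    the move from the first to the second increases every [sum_i f (x_i)] with
    [f^(k) >= 0]: interpolate [f] at the roots, other than [r], of the polynomial
    half-way between. Real-rooted polynomials differing by a constant have
    alternating roots, by comparison through their common critical points; this
    shows that from every point at which the k-th power sum is not maximal some
    move of this kind exists. By compactness, below any [a] one can then climb
    continuously in the k-th power sum, so on [S_k] the order above and the order
    of the k-th power sums together imply k-majorization. The path is parametrized
    by the k-th power sum: at each level it takes the point of the order interval
    [[b, a]] with the largest first coordinate. *)

Module MonotonePath.

Import all_boot all_order all_algebra polyrcf ring lra zify.
Import all_classical all_reals all_analysis Rstruct Rstruct_topology.
Set Implicit Arguments.
Unset Strict Implicit.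
Unset Printing Implicit Defensive.
Import Order.TTheory GRing.Theory Num.Theory numFieldNormedType.Exports.
Local Open Scope classical_set_scope.
Local Open Scope ring_scope.

(** * Real-rooted polynomials *)

Definition rpoly (F : comNzRingType) n (x : nat -> F) : {poly F} :=
  \prod_(i < n) ('X - (x i)%:P).

Definition dec (F : numDomainType) n (x : nat -> F) :=
  forall i j, (i <= j)%N -> (j < n)%N -> x j <= x i.

Definition sdec (F : numDomainType) n (x : nat -> F) :=
  forall i j, (i < j)%N -> (j < n)%N -> x j < x i.

Section RootPolynomials.
Variable F : rcfType.
Implicit Types (x y c : nat -> F) (p : {poly F}) (t : F).

Lemma sdec_dec n x : sdec n x -> dec n x.
Proof.
move=> xs i j; rewrite leq_eqVlt => /predU1P[->//|ij jn]; exact/ltW/xs.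
Qed.

Lemma dec_step n x : (forall i, (i.+1 < n)%N -> x i.+1 <= x i) -> dec n x.
Proof.
move=> xs i j; elim: j => [|j IH]; first by rewrite leqn0 => /eqP->.
rewrite leq_eqVlt => /predU1P[->//|]; rewrite ltnS => ij jn.
exact: le_trans (xs _ jn) (IH ij (ltnW jn)).
Qed.

Lemma sdec_step n x : (forall i, (i.+1 < n)%N -> x i.+1 < x i) -> sdec n x.
Proof.
move=> xs i j; elim: j => [//|j IH].
rewrite ltnS leq_eqVlt => /predU1P[->|ij] jn; first exact: xs.
exact: lt_trans (xs _ jn) (IH ij (ltnW jn)).
Qed.

Lemma rpolyE n x : rpoly n x = \prod_(z <- mkseq x n) ('X - z%:P).
Proof. by rewrite /rpoly -(big_mkord xpredT (fun i => 'X - (x i)%:P)) big_map /index_iota subn0. Qed.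

Lemma rpolyS n x : rpoly n.+1 x = rpoly n x * ('X - (x n)%:P).
Proof. by rewrite /rpoly big_ord_recr. Qed.

Lemma size_rpoly n x : size (rpoly n x) = n.+1.
Proof. by rewrite rpolyE size_prod_XsubC size_mkseq. Qed.

Lemma monic_rpoly n x : rpoly n x \is monic.
Proof. exact: monic_prod_XsubC. Qed.

Lemma coef_rpoly n x : (rpoly n x)`_n = 1.
Proof. by have /monicP := monic_rpoly n x; rewrite lead_coefE size_rpoly. Qed.

Lemma rpoly_neq0 n x : rpoly n x != 0.
Proof. exact/monic_neq0/monic_rpoly. Qed.

Lemma horner_rpoly n x t : (rpoly n x).[t] = \prod_(i < n) (t - x i).
Proof. by rewrite /rpoly horner_prod; apply: eq_bigr => i _; rewrite !hornerE. Qed.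

Lemma horner_rpoly_root n x i : (i < n)%N -> (rpoly n x).[x i] = 0.
Proof.
by move=> lin; rewrite horner_rpoly (bigD1 (Ordinal lin)) //= subrr mul0r.
Qed.

Lemma root_rpoly n x t : (rpoly n x).[t] = 0 -> exists2 i, (i < n)%N & t = x i.
Proof.
move/rootP; rewrite rpolyE root_prod_XsubC => /mapP[i]; rewrite mem_iota => /= ? ->.
by exists i.
Qed.

Lemma rpoly_inj n x y : dec n x -> dec n y -> rpoly n x = rpoly n y ->
  forall i, (i < n)%N -> x i = y i.
Proof.
move=> xs ys; rewrite !rpolyE => /prod_XsubC_eq xy i lin.
have srt z : dec n z -> sorted (>=%O) (mkseq z n).
  move=> zs; apply/(sortedP 0) => j; rewrite size_mkseq => jn.
  by rewrite !nth_mkseq ?(ltnW jn)//; apply: zs.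
have /(congr1 (fun s => nth 0 s i)) : mkseq x n = mkseq y n.
  apply: (@sorted_eq _ (>=%O)) xy; try exact: srt; first exact: ge_trans.
  exact: ge_anti.
by rewrite !nth_mkseq.
Qed.

Lemma rpoly_of_roots p n c : (size p <= n.+1)%N -> p`_n = 1 -> sdec n c ->
  (forall i, (i < n)%N -> root p (c i)) -> p = rpoly n c.
Proof.
move=> sp lp cs cr.
have szp : size p = n.+1.
  apply/eqP; rewrite eqn_leq sp ltnNge; apply/negP => /leq_sizeP/(_ n (leqnn n)).
  by rewrite lp; apply/eqP/oner_neq0.
rewrite [LHS](@all_roots_prod_XsubC _ p (mkseq c n)).
- by rewrite rpolyE lead_coefE szp lp scale1r.
- by rewrite size_mkseq.
- by apply/allP => z /mapP[i]; rewrite mem_iota => /= lin ->; apply: cr.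
- rewrite uniq_rootsE; apply/mkseq_uniqP => i j; rewrite !inE => lin ljn.
  case: (ltngtP i j) => // [ij|ji] cij.
  + by have := cs _ _ ij ljn; rewrite cij ltxx.
  + by have := cs _ _ ji lin; rewrite cij ltxx.
Qed.

Lemma rpoly_sign_ge0 n m x t : (m <= n)%N ->
  (forall i, (i < m)%N -> t <= x i) ->
  (forall i, (m <= i)%N -> (i < n)%N -> x i <= t) ->
  0 <= (-1) ^+ m * (rpoly n x).[t].
Proof.
elim: n m => [|n IH] m mn xm xn.
  by move: mn; rewrite leqn0 => /eqP->; rewrite /rpoly big_ord0 hornerC mulr1 ler01.
rewrite rpolyS hornerM hornerXsubC; move: mn; rewrite leq_eqVlt => /predU1P[mE|mn].
  rewrite mE in xm xn *.
  have h1 : 0 <= (-1) ^+ n * (rpoly n x).[t].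
    apply: IH => // [i lin|i ni lin]; first by apply: xm; lia.
    by move: ni; rewrite leqNgt lin.
  have h2 := xm n (ltnSn n); rewrite exprS.
  have h3 : 0 <= x n - t by lra.
  have -> : -1 * (-1) ^+ n * ((rpoly n x).[t] * (t - x n))
     = ((-1) ^+ n * (rpoly n x).[t]) * (x n - t) by ring.
  exact: mulr_ge0.
have h1 : 0 <= (-1) ^+ m * (rpoly n x).[t].
  by apply: IH => // i mi lin; apply: xn => //; lia.
rewrite mulrA mulr_ge0 // subr_ge0; exact: xn.
Qed.

Lemma rpoly_sign_gt0 n m x t : (m <= n)%N ->
  (forall i, (i < m)%N -> t < x i) ->
  (forall i, (m <= i)%N -> (i < n)%N -> x i < t) ->
  0 < (-1) ^+ m * (rpoly n x).[t].
Proof.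
move=> mn xm xn; rewrite lt_neqAle rpoly_sign_ge0 //; last 2 first.
- by move=> i /xm/ltW.
- by move=> i mi /(xn _ mi)/ltW.
rewrite andbT eq_sym mulf_neq0 ?signr_eq0 //; apply/eqP => /root_rpoly[i lin ti].
have [/xm|/xn] := ltnP i m; first by rewrite ti ltxx.
by move=> /(_ lin); rewrite ti ltxx.
Qed.

(** The intermediate value theorem gives a root in each of the [n] gaps, and a monic polynomial of
    degree [n] has no others. Real-rootedness of shifted polynomials is always derived from this. *)
Lemma alternation n p (s_ : nat -> F) : (size p <= n.+1)%N -> p`_n = 1 ->
  (forall i, (i < n)%N -> s_ i.+1 < s_ i) ->
  (forall i, (i <= n)%N -> 0 < (-1) ^+ i * p.[s_ i]) ->
  exists c, [/\ sdec n c, p = rpoly n c &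
    forall i, (i < n)%N -> s_ i.+1 < c i < s_ i].
Proof.
move=> sp lp ts tp.
have /choice[c cP] : forall i, exists r : F,
    (i < n)%N -> (s_ i.+1 < r < s_ i) && root p r.
  move=> i; case: (ltnP i n) => lin; last by exists 0.
  have [|c] := @poly_ivtoo _ p _ _ (ltW (ts _ lin)).
    have h1 := tp i (ltnW lin); have h2 := tp i.+1 lin.
    have := mulr_gt0 h1 h2; rewrite exprS.
    have -> : (-1) ^+ i * p.[s_ i] * (-1 * (-1) ^+ i * p.[s_ i.+1]) =
       - (((-1) ^+ i) ^+ 2 * (p.[s_ i.+1] * p.[s_ i])) by ring.
    by rewrite sqrr_sign mul1r oppr_gt0.
  by rewrite in_itv /= => ci cr; exists c => _; rewrite ci cr.
have cs : sdec n c.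
  apply: sdec_step => i lin.
  have /andP[/andP[_ h1] _] := cP _ lin.
  by have /andP[/andP[h2 _] _] := cP _ (ltnW lin); apply: lt_trans h2.
exists c; split => // [|i lin]; last by have /andP[] := cP _ lin.
by apply: rpoly_of_roots => // i lin; have /andP[] := cP _ lin.
Qed.

Lemma rolle_sdec n x : sdec n.+1 x ->
  exists xi, [/\ sdec n xi, (forall i, (i < n)%N -> x i.+1 <= xi i <= x i) &
    (rpoly n.+1 x)^`() = n.+1%:R *: rpoly n xi].
Proof.
move=> xs; set p := rpoly n.+1 x.
have n0 : n.+1%:R != 0 :> F by rewrite pnatr_eq0.
have /choice[c cP] : forall i, exists r : F,
    (i < n)%N -> (x i.+1 < r < x i) && root p^`() r.
  move=> i; case: (ltnP i n) => lin; last by exists 0.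
  have [//||c] := @poly_rolle _ (x i.+1) (x i) p.
  - by apply: xs.
  - by rewrite !horner_rpoly_root //; lia.
  - by rewrite in_itv /= => ci /rootP cr; exists c => _; rewrite ci cr.
have cs : sdec n c.
  apply: sdec_step => i lin.
  have /andP[/andP[_ h1] _] := cP _ lin.
  by have /andP[/andP[h2 _] _] := cP _ (ltnW lin); apply: lt_trans h2.
exists c; split => // [i lin|].
  by have /andP[/andP[/ltW-> /ltW->]] := cP _ lin.
rewrite -(@rpoly_of_roots (n.+1%:R^-1 *: p^`())) //.
- by rewrite scalerA mulfV // scale1r.
- rewrite (leq_trans (size_scale_leq _ _)) //.
  by have := lt_size_deriv (rpoly_neq0 n.+1 x); rewrite size_rpoly.
- by rewrite coefZ coef_deriv coef_rpoly mulVf.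
- by move=> i lin; rewrite rootZ ?invr_eq0 //; have /andP[] := cP _ lin.
Qed.

Lemma sort_vector n x : exists y, [/\ dec n y, rpoly n y = rpoly n x &
  forall g : F -> F, \sum_(i < n) g (y i) = \sum_(i < n) g (x i)].
Proof.
pose s := sort (>=%O) (mkseq x n); pose y i := nth 0 s i.
have szs : size s = n by rewrite size_sort size_mkseq.
have ys : mkseq y n = s.
  by apply: (@eq_from_nth _ 0); rewrite ?size_mkseq // => i lin; rewrite nth_mkseq.
have pys : perm_eq (mkseq y n) (mkseq x n) by rewrite ys perm_sort.
exists y; split.
- apply: dec_step => i lin.
  have /(sortedP 0) : sorted (>=%O) s by apply: sort_sorted => a b; apply: ge_total.
  by apply; rewrite szs.
- by rewrite !rpolyE; apply: perm_big.
- move=> g.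
  have E (z : nat -> F) : \sum_(i < n) g (z i) = \sum_(t <- mkseq z n) g t.
    by rewrite -(big_mkord xpredT (fun i => g (z i))) big_map /index_iota subn0.
  by rewrite !E; apply: perm_big.
Qed.

End RootPolynomials.

(** * Limits of root vectors *)

Section Limits.
Variable R : realType.
Implicit Types (x y : nat -> R) (u : nat -> nat -> R).

Definition vcvg n u x := forall i, (i < n)%N -> u m i @[m --> \oo] --> x i.

(** The condition [m <= f m] makes [f] tend to infinity, which is what limits require, and it is
    stable under composition. *)
Lemma cvg_subseq (v : nat -> R) (l : R) (f : nat -> nat) :
  (forall m, (m <= f m)%N) -> v m @[m --> \oo] --> l -> v (f m) @[m --> \oo] --> l.
Proof.
move=> fm vl; apply: (cvg_comp f v) vl.
apply/cvgnyPge => A; near=> m; apply: leq_trans (fm m).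
by near: m; exists A.
Unshelve. all: by end_near. Qed.

Lemma increasing_seq_ge (f : nat -> nat) : increasing_seq f -> forall m, (m <= f m)%N.
Proof.
move=> fi; elim => // m IH; apply: leq_ltn_trans IH _.
by have /increasing_seqP := fi; apply.
Qed.

Lemma bounded_vcvg n u B : (forall m i, (i < n)%N -> `|u m i| <= B) ->
  exists f x, (forall m, (m <= f m)%N) /\ vcvg n (fun m => u (f m)) x.
Proof.
elim: n => [|n IH] uB; first by exists id, (fun=> 0).
have [|f [x [fm fx]]] := IH; first by move=> m i lin; apply: uB; lia.
have [|g gi /cvg_ex[l gl]] := @bolzano_weierstrass R (fun m => u (f m) n).
  exists B; split; first exact: num_real.
  by move=> C BC m _ /=; apply: le_trans (uB _ _ _) (ltW BC).
have gm := increasing_seq_ge gi.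
exists (f \o g), (fun i => if i == n then l else x i); split.
  by move=> m; apply: leq_trans (gm m) (fm _).
move=> i; rewrite ltnS leq_eqVlt; case: eqVneq => [-> _|iN /= lin] //.
exact: (@cvg_subseq (fun m => u (f m) i)) (fx _ lin).
Qed.

Lemma vcvg_sub n u x (f : nat -> nat) : (forall m, (m <= f m)%N) ->
  vcvg n u x -> vcvg n (fun m => u (f m)) x.
Proof. by move=> fm ux i lin; apply: (@cvg_subseq (fun m => u m i)) (ux i lin). Qed.

(** Compactness: if a coordinate stayed at distance [e] from its limit along a subsequence, a
    further extraction would give a cluster point other than [x]. *)
Lemma vcvg_unique_cluster n u B x : (forall m i, (i < n)%N -> `|u m i| <= B) ->
  (forall f y, (forall m, (m <= f m)%N) -> vcvg n (fun m => u (f m)) y ->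
     forall i, (i < n)%N -> y i = x i) -> vcvg n u x.
Proof.
move=> uB ux i lin; apply: contrapT => nux.
have [e e0 /choice[f fP]] : exists2 e, 0 < e & forall N, exists m,
    (N <= m)%N /\ e <= `|x i - u m i|.
  apply: contrapT => H; apply: nux; apply/cvgrPdist_lt => e e0.
  apply: contrapT => H'; apply: H; exists e => // N.
  apply: contrapT => H''; apply: H'; exists N => // m /= Nm.
  by rewrite ltNge; apply/negP => ?; apply: H''; exists m.
have [|g [y [gm gy]]] := @bounded_vcvg n (fun m => u (f m)) B.
  by move=> m j; apply: uB.
have yx : y i = x i.
  apply: (ux (f \o g)) => // m; exact: leq_trans (gm m) (fP _).1.
have := gy i lin; rewrite yx => /cvgrPdist_lt/(_ _ e0)[N _ /(_ N (leqnn N))] /=.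
by rewrite ltNge (fP (g N)).2.
Qed.

Lemma cvg_rpoly n u x t : vcvg n u x ->
  (rpoly n (u m)).[t] @[m --> \oo] --> (rpoly n x).[t].
Proof.
elim: n => [|n IH] ux.
  by rewrite /rpoly big_ord0; under eq_fun do rewrite big_ord0; exact: cvg_cst.
rewrite rpolyS hornerM hornerXsubC; under eq_fun do rewrite rpolyS hornerM hornerXsubC.
apply: cvgM; first by apply: IH => i lin; apply: ux; lia.
by apply: cvgB; [exact: cvg_cst|exact: ux].
Qed.

Lemma cvg_deriv_rpoly n u x t : vcvg n u x ->
  ((rpoly n (u m))^`()).[t] @[m --> \oo] --> ((rpoly n x)^`()).[t].
Proof.
elim: n => [|n IH] ux.
  by rewrite /rpoly big_ord0; under eq_fun do rewrite big_ord0; exact: cvg_cst.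
have E (z : nat -> R) : ((rpoly n.+1 z)^`()).[t] =
    ((rpoly n z)^`()).[t] * (t - z n) + (rpoly n z).[t].
  by rewrite rpolyS derivM derivXsubC mulr1 hornerD hornerM hornerXsubC.
rewrite E; under eq_fun do rewrite E.
have ux' : vcvg n u x by move=> i lin; apply: ux; lia.
apply: cvgD; last exact: cvg_rpoly.
apply: cvgM; first exact: IH.
by apply: cvgB; [exact: cvg_cst|exact: ux].
Qed.

Lemma cvg_rsum n u x (g : R -> R) : continuous g -> vcvg n u x ->
  \sum_(i < n) g (u m i) @[m --> \oo] --> \sum_(i < n) g (x i).
Proof.
move=> gc; elim: n => [|n IH] ux.
  by rewrite big_ord0; under eq_fun do rewrite big_ord0; exact: cvg_cst.
rewrite big_ord_recr; under eq_fun do rewrite big_ord_recr /=.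
apply: cvgD; first by apply: IH => i lin; apply: ux; lia.
apply: (@cvg_comp _ _ _ (fun m => u m n) g _ _ _ (ux n (ltnSn n))); exact: gc.
Qed.

Lemma vcvg_dec n u x : (forall m, dec n (u m)) -> vcvg n u x -> dec n x.
Proof.
move=> ud ux i j ij jn; apply: (ler_cvg_to (ux _ jn) (ux _ (leq_ltn_trans ij jn))).
by near=> m; apply: ud.
Unshelve. all: by end_near. Qed.

Lemma eq_poly_horner (p q : {poly R}) : (forall t, p.[t] = q.[t]) -> p = q.
Proof.
move=> pq; apply/eqP; rewrite -subr_eq0; apply/negPn/negP => d0.
have := @max_poly_roots _ _ (mkseq (fun i => i%:R) (size (p - q))) d0.
rewrite size_mkseq ltnn => H; suff: false by []; apply: H.
- by apply/allP => z _; apply/rootP; rewrite hornerD hornerN pq subrr.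
- by apply/mkseq_uniqP => i j _ _ /eqP; rewrite eqr_nat => /eqP.
Qed.

(** Continuity of ordered roots: every cluster point has the limit polynomial, whose decreasing list
    of roots is unique. *)
Lemma vcvg_rpoly_dec n u x B : (forall m i, (i < n)%N -> `|u m i| <= B) ->
  (forall m, dec n (u m)) -> dec n x ->
  (forall t, (rpoly n (u m)).[t] @[m --> \oo] --> (rpoly n x).[t]) -> vcvg n u x.
Proof.
move=> uB ud xd ux; apply: (vcvg_unique_cluster uB) => f y fm fy.
apply: rpoly_inj => //; first by apply: vcvg_dec fy => m; apply: ud.
apply: eq_poly_horner => t.
apply: (@cvg_unique _ _ ((fun m => (rpoly n (u (f m))).[t]) @ \oo)) => //.
  exact: cvg_rpoly.
exact: (@cvg_subseq (fun m => (rpoly n (u m)).[t])).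
Qed.

(* Multiple roots are spread out to [x i - i / m] and the critical points of the
   perturbed polynomials are followed to the limit. *)
Lemma rolle_dec n x : dec n.+1 x ->
  exists xi, [/\ dec n xi, (forall i, (i < n)%N -> x i.+1 <= xi i <= x i) &
    (rpoly n.+1 x)^`() = n.+1%:R *: rpoly n xi].
Proof.
move=> xd; pose v m i := x i - i%:R / m.+1%:R.
have vs m : sdec n.+1 (v m).
  apply: sdec_step => i lin; rewrite /v; have := xd _ _ (leqnSn i) lin.
  have : 0 < m.+1%:R^-1 :> R by rewrite invr_gt0 ltr0Sn.
  rewrite -[i.+1%:R]natr1 mulrDl mul1r; move: (_^-1) (i%:R) => w z w0 xx; lra.
have vx : vcvg n.+1 v x.
  move=> i lin; rewrite -[X in _ --> X]subr0.
  apply: cvgB; first exact: cvg_cst.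
  rewrite -[X in _ --> X](mulr0 i%:R); apply: cvgM; first exact: cvg_cst.
  exact: cvg_harmonic.
have /choice[z zP] := fun m => rolle_sdec (vs m).
pose B := \sum_(i < n.+1) (`|x i| + i%:R).
have xB i : (i < n.+1)%N -> `|x i| + i%:R <= B.
  move=> lin; rewrite /B (bigD1 (Ordinal lin)) //= lerDl; apply: sumr_ge0 => j _.
  by apply: addr_ge0.
have vB m i : (i < n.+1)%N -> `|v m i| <= B.
  move=> lin; apply: le_trans (xB i lin); apply: le_trans (ler_normB _ _) _.
  rewrite lerD2l normrM ger0_norm // ger0_norm ?invr_ge0 //.
  by rewrite ler_piMr // invf_le1 // ler1n.
have [|f [xi [fm fxi]]] := @bounded_vcvg n z B.
  move=> m i lin; have [_ /(_ i lin)/andP[z1 z2] _] := zP m.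
  have := vB m i (ltnW lin); have := vB m i.+1 lin.
  by rewrite !ler_norml => /andP[? ?] /andP[? ?]; apply/andP; split; lra.
have vf := vcvg_sub fm vx.
exists xi; split.
- by apply: vcvg_dec fxi => m; apply: sdec_dec; have [] := zP (f m).
- move=> i lin; apply/andP; split.
  + apply: (ler_cvg_to (vf i.+1 lin) (fxi i lin)); near=> m.
    by have [_ /(_ i lin)/andP[]] := zP (f m).
  + apply: (ler_cvg_to (fxi i lin) (vf i (ltnW lin))); near=> m.
    by have [_ /(_ i lin)/andP[]] := zP (f m).
- apply: eq_poly_horner => t; rewrite hornerZ.
  apply: (@cvg_unique _ _ ((fun m => ((rpoly n.+1 (v (f m)))^`()).[t]) @ \oo)) => //.
    exact: cvg_deriv_rpoly.
  have -> : (fun m => ((rpoly n.+1 (v (f m)))^`()).[t]) =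
      (fun m => n.+1%:R * (rpoly n (z (f m))).[t]).
    by apply/funext => m; have [_ _ ->] := zP (f m); rewrite hornerZ.
  by apply: cvgM; [exact: cvg_cst|exact: cvg_rpoly].
Unshelve. all: by end_near. Qed.

End Limits.

(** * Interlacing *)

Section Interlacing.
Variable R : realType.
Implicit Types (x y : nat -> R).

Lemma odd_signr i : odd i -> (-1) ^+ i = -1 :> R.
Proof. by rewrite -signr_odd => ->; rewrite expr1. Qed.

Lemma even_signr i : ~~ odd i -> (-1) ^+ i = 1 :> R.
Proof. by rewrite -signr_odd => /negbTE->; rewrite expr0. Qed.

Lemma rpoly_shift n xi eta (k t : R) : rpoly n eta = rpoly n xi - k%:P ->
  (rpoly n eta).[t] = (rpoly n xi).[t] - k.
Proof. by move=> ->; rewrite hornerD hornerN hornerC. Qed.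

(** Both polynomials have the same derivative, hence the same critical points [z]. The two roots of
    rank [i] lie between the same consecutive critical points, where the derivative has weakly the
    sign of (-1)^i. As the polynomial of [xi] is 0 at [xi i] and [k > 0] at [eta i], this sign
    decides their order. *)
Lemma interlace n xi eta (k : R) : dec n xi -> dec n eta -> 0 < k ->
  rpoly n eta = rpoly n xi - k%:P ->
  forall i, (i < n)%N -> if odd i then eta i < xi i else xi i < eta i.
Proof.
case: n => // n xd ed k0 E i lin.
have [z [zd zx Dz]] := rolle_dec xd; have [z' [zd' ze Dz']] := rolle_dec ed.
have zz : forall i, (i < n)%N -> z' i = z i.
  apply: rpoly_inj => //; apply: (@scalerI _ _ (n.+1%:R : R)).
    by rewrite pnatr_eq0.
  by rewrite -Dz -Dz' E derivB derivC subr0.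
(* The disjunctions cover both possible orders of [xi i] and [eta i], so that [Hs] applies to the
   mean value point in either case. *)
have Hs c : c <= xi i \/ c <= eta i -> xi i <= c \/ eta i <= c ->
    0 <= (-1) ^+ i * (rpoly n z).[c].
  move=> c1 c2; apply: rpoly_sign_ge0 => // j jlt; last first.
    move=> ljn; have := zx j ljn; have := ze j ljn; rewrite zz // => /andP[_ h1] /andP[_ h2].
    have := xd i j jlt (ltnW ljn); have := ed i j jlt (ltnW ljn).
    by case: c2 => c2 ? ?; lra.
  have ljn : (j < n)%N by lia.
  have := zx j ljn; have := ze j ljn; rewrite zz // => /andP[h1 _] /andP[h2 _].
  have := xd j.+1 i jlt lin; have := ed j.+1 i jlt lin.
  by case: c1 => c1 ? ?; lra.
have Pe : (rpoly n.+1 xi).[eta i] = k.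
  by apply/eqP; rewrite -subr_eq0 -(rpoly_shift _ E) horner_rpoly_root.
have Px := horner_rpoly_root xi lin.
have ne : xi i != eta i by apply/eqP => xe; rewrite -xe Px in Pe; lra.
have n0 : 0 < n.+1%:R :> R by rewrite ltr0Sn.
case: ifP => oi; rewrite ltNge; apply/negP; rewrite le_eqVlt.
  rewrite (negbTE ne) /= => xe.
  have [c] := poly_mvt (rpoly n.+1 xi) xe; rewrite in_itv /= => /andP[c1 c2].
  rewrite Pe Px Dz hornerZ => M.
  have := Hs c (or_intror (ltW c2)) (or_introl (ltW c1)).
  rewrite odd_signr // => S; have : 0 < k - 0 by lra.
  by rewrite M pmulr_lgt0 ?subr_gt0 // pmulr_rgt0 //; lra.
rewrite eq_sym (negbTE ne) /= => xe.
have [c] := poly_mvt (rpoly n.+1 xi) xe; rewrite in_itv /= => /andP[c1 c2].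
rewrite Pe Px Dz hornerZ => M.
have := Hs c (or_introl (ltW c2)) (or_intror (ltW c1)).
rewrite even_signr ?oi // => S; have : 0 - k < 0 by lra.
by rewrite M pmulr_llt0 ?subr_gt0 // pmulr_rlt0 //; lra.
Qed.

Lemma rpoly_subC_size n x (k : R) : (0 < n)%N ->
  (size (rpoly n x - k%:P)%R <= n.+1)%N /\ (rpoly n x - k%:P)`_n = 1.
Proof.
move=> n0; split; last by rewrite coefB coefC coef_rpoly eqn0Ngt n0 subr0.
rewrite (leq_trans (size_polyD _ _)) // size_rpoly size_polyN geq_max leqnn.
by rewrite (leq_trans (size_polyC_leq1 _)).
Qed.

Lemma shift_between n xi eta (k k' : R) : dec n xi -> dec n eta ->
  rpoly n eta = rpoly n xi - k%:P -> 0 < k' < k ->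
  exists c, sdec n c /\ rpoly n c = rpoly n xi - k'%:P.
Proof.
move=> xd ed E /andP[k'0 k'k]; have k0 := lt_trans k'0 k'k.
case: n => [|n] in xd ed E *.
  by move/(rpoly_shift 0): E; rewrite /rpoly !big_ord0 hornerC; lra.
have il := interlace xd ed k0 E.
have [sz lc] := @rpoly_subC_size n.+1 xi k' isT.
(* At each rank up to [n], [s_] takes the larger of the two roots; the shifted polynomial is
   [k - k'] at roots [eta] and [- k'] at roots [xi]. The extra point of index [n.+1] is the smaller
   root of rank [n], hence the truncation [j]. *)
pose j i := minn i n; have jn i : (j i < n.+1)%N by rewrite /j; lia.
pose s_ i := if odd i then xi (j i) else eta (j i).
have [| |c [cs Ec _]] := @alternation _ _ _ s_ sz lc.
- move=> i lin; have := il _ lin; rewrite /s_ /=.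
  have ji : j i = i by rewrite /j; lia.
  have jij : (i <= j i.+1)%N by rewrite /j; lia.
  have := xd _ _ jij (jn _); have := ed _ _ jij (jn _).
  by rewrite ji; case: (odd i) => /= h1 h2 h3; lra.
- move=> i lin; rewrite hornerD hornerN hornerC /s_; case: ifP => oi.
    by rewrite odd_signr // horner_rpoly_root //; lra.
  rewrite even_signr ?oi //; have := rpoly_shift (eta (j i)) E.
  by rewrite horner_rpoly_root //; lra.
- by exists c.
Qed.

Lemma pos_lower_bound (g : nat -> R) N : (forall i, (i <= N)%N -> 0 < g i) ->
  exists2 d, 0 < d & forall i, (i <= N)%N -> d < g i.
Proof.
elim: N => [|N IH] gp.
  have g0 := gp 0%N (leqnn _); exists (g 0%N / 2); first by lra.
  by move=> i; rewrite leqn0 => /eqP->; lra.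
have [|d d0 dg] := IH; first by move=> i iN; apply: gp; lia.
have gN := gp _ (leqnn N.+1); exists (Num.min d (g N.+1 / 2)).
  by rewrite lt_min d0 /=; lra.
move=> i; rewrite leq_eqVlt => /predU1P[->|iN]; first by rewrite gt_min; apply/orP; right; lra.
by rewrite gt_min dg.
Qed.

(** At a double root of ranks [i] and [i.+1] with [i] even, the polynomial touches zero from above,
    so lowering it splits the root; with [i] odd, lowering would destroy it. *)
Lemma shift_odd_gaps n y : (0 < n)%N -> dec n y ->
  (forall i, odd i -> (i.+1 < n)%N -> y i.+1 < y i) ->
  exists2 d0, 0 < d0 & forall d, 0 < d <= d0 ->
    exists c, sdec n c /\ rpoly n c = rpoly n y - d%:P.
Proof.
move=> n0 yd yo.
(* Alternation points: those of even index lie in the gap just below a root of odd rank, or beyond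
   all roots, and the polynomial is positive there; those of odd index are roots of even rank, where
   the lowered polynomial is [- d]. *)
pose e_ i := if i == 0%N then y 0%N + 1 else
  if (i < n)%N then (y i.-1 + y i) / 2 else y n.-1 - 1.
pose s_ i := if odd i then y i.-1 else e_ i.
have e1 i : ~~ odd i -> (i <= n)%N -> forall j, (j < i)%N -> e_ i < y j.
  case: i => // i oi lin j ji; rewrite /e_ /=.
  have h1 := yd j i ji lin; case: ifP => h2; last first.
    have nE : n.-1 = i by lia.
    by rewrite nE; lra.
  have oi' : odd i by move: oi; rewrite /= negbK.
  by have := yo i oi' h2; lra.
have e2 i : ~~ odd i -> (i <= n)%N -> forall j, (i <= j)%N -> (j < n)%N -> y j < e_ i.
  case: i => [|i] oi lin j ji jn; rewrite /e_ /=.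
    by have := yd _ _ ji jn; lra.
  have -> : (i.+1 < n)%N by lia.
  have h1 := yd _ _ ji jn; have h2 : (i.+1 < n)%N by lia.
  have oi' : odd i by move: oi; rewrite /= negbK.
  by have := yo i oi' h2; lra.
(* The value 1 at odd indices is a dummy, positive as [pos_lower_bound] demands. *)
pose g i := if odd i then 1 else (rpoly n y).[s_ i].
have [|d0 d00 dg] := @pos_lower_bound g n.
  move=> i lin; rewrite /g /s_; case: ifP => oi //.
  have := @rpoly_sign_gt0 _ n i y (e_ i) lin; rewrite even_signr ?oi // mul1r; apply.
  - by apply: e1 => //; rewrite oi.
  - by apply: e2 => //; rewrite oi.
exists d0 => // d /andP[dp dd0].
have [sz lc] := @rpoly_subC_size n y d n0.
have [| |c [cs Ec _]] := @alternation _ _ _ s_ sz lc.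
- move=> i lin; rewrite /s_ /=; case: (boolP (odd i)) => oi /=.
    by apply: e1; rewrite /= ?oi //; lia.
  by apply: e2 => //; exact: ltnW.
- move=> i lin; rewrite hornerD hornerN hornerC; have := dg i lin.
  rewrite /g /s_; case: (boolP (odd i)) => oi h.
    rewrite odd_signr // horner_rpoly_root; first lra.
    by case: i lin oi h.
  by rewrite even_signr // mul1r; lra.
- by exists c.
Qed.

(* In other words, a point with such a pair of double roots maximises the k-th
   power sum on its fibre. Ranks are counted from 0, the largest root. *)
Lemma collision_maximal n x a (al be : R) o e : dec n x -> dec n a ->
  rpoly n a = rpoly n x - al *: 'X + be%:P -> 0 < al ->
  odd o -> ~~ odd e -> (o < e)%N -> (e.+1 < n)%N ->
  x o = x o.+1 -> x e = x e.+1 -> False.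
Proof.
case: n => // n xd ad E al0 oo ee oe; rewrite ltnS => en xo xe.
have [xi [xid xix Dx]] := rolle_dec xd; have [eta [etad etaa Da]] := rolle_dec ad.
have n0 : 0 < n.+1%:R :> R by rewrite ltr0Sn.
have E' : rpoly n eta = rpoly n xi - (al / n.+1%:R)%:P.
  apply: (@scalerI _ _ (n.+1%:R : R)); first by rewrite gt_eqF.
  rewrite -Da scalerBr -Dx E derivD derivB derivZ derivX derivC addr0.
  by rewrite -mul_polyC mulr1 -mul_polyC -polyCM mulrCA mulfV ?mulr1 ?gt_eqF.
have il := interlace xid etad (divr_gt0 al0 n0) E'.
have Ea t : (rpoly n.+1 a).[t] = (rpoly n.+1 x).[t] - al * t + be.
  by rewrite E !hornerE.
have on := ltn_trans oe en.
have on1 : (o < n.+1)%N by exact: ltnW.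
have en1 : (e < n.+1)%N by exact: ltnW.
(* The critical point squeezed between two equal roots is that root. Hence the polynomial of [x]
   increases strictly from [eta o] to its zero [xi o], and weakly from its zero [xi e] to
   [eta e]. *)
have xio : xi o = x o by apply/eqP; rewrite eq_le; have := xix o on; rewrite -xo andbC.
have xie : xi e = x e by apply/eqP; rewrite eq_le; have := xix e en; rewrite -xe andbC.
have ho : eta o < xi o by have := il _ on; rewrite oo.
have he : xi e < eta e by have := il _ en; rewrite (negbTE ee).
have ho1 : xi o.+1 < eta o.
  apply: lt_le_trans (etad o o.+1 (leqnSn _) (leq_ltn_trans oe en)).
  by have := il _ (leq_ltn_trans oe en); rewrite /= oo.
have Po : (rpoly n.+1 x).[eta o] < 0.
  have [c] := poly_mvt (rpoly n.+1 x) ho; rewrite in_itv /= => /andP[c1 c2].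
  rewrite xio (horner_rpoly_root x on1).
  rewrite -xio Dx hornerZ => M; rewrite -oppr_gt0 -[X in 0 < X]add0r M.
  apply: mulr_gt0; last by rewrite subr_gt0.
  apply: mulr_gt0 => //; have := @rpoly_sign_gt0 _ n o.+1 xi c.
  rewrite even_signr /= ?oo // mul1r; apply => // i hi.
    exact: lt_le_trans c2 (xid i o hi on).
  by move=> lin; apply: le_lt_trans (xid o.+1 i hi lin) (lt_trans ho1 c1).
have Pe : 0 <= (rpoly n.+1 x).[eta e].
  have [c] := poly_mvt (rpoly n.+1 x) he; rewrite in_itv /= => /andP[c1 c2].
  rewrite xie (horner_rpoly_root x en1).
  rewrite subr0 => ->; rewrite -xie Dx hornerZ.
  apply: mulr_ge0; last by rewrite subr_ge0 ltW.
  apply: mulr_ge0; first exact: ltW.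
  have := @rpoly_sign_ge0 _ n e xi c; rewrite even_signr // mul1r; apply => [|i hi|i hi lin].
  - exact: ltnW.
  - have e1n : (e.-1 < n)%N := leq_ltn_trans (leq_pred _) en.
    apply: le_trans (xid i e.-1 _ e1n); last by rewrite -ltnS (ltn_predK oe).
    have := il _ e1n; have -> : odd e.-1 by case: (e) ee oe => //= e' /negPn.
    have := etad e.-1 e (leq_pred _) en; lra.
  - exact: le_trans (xid e i hi lin) (ltW c1).
have Ao : 0 <= (rpoly n.+1 a).[eta o].
  have := @rpoly_sign_ge0 _ n.+1 o.+1 a (eta o); rewrite even_signr /= ?oo // mul1r.
  have /andP[h1 h2] := etaa _ on.
  apply => [|i hi|i hi lin]; first exact: leqW.
    exact: le_trans h2 (ad i o hi on1).
  exact: le_trans (ad o.+1 i hi lin) h1.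
have Ae : (rpoly n.+1 a).[eta e] <= 0.
  have := @rpoly_sign_ge0 _ n.+1 e.+1 a (eta e); rewrite odd_signr /= ?ee // mulN1r oppr_ge0.
  have /andP[h1 h2] := etaa _ en.
  apply => [|i hi|i hi lin]; first exact: leqW.
    exact: le_trans h2 (ad i e hi en1).
  exact: le_trans (ad e.+1 i hi lin) h1.
(* [Po] and [Ao] give [al * eta o < be], [Pe] and [Ae] give [be <= al * eta e], against
   [eta e <= eta o]. *)
have := etad o e (ltnW oe) en; rewrite -(ler_pM2l al0).
by rewrite !Ea in Ao Ae; lra.
Qed.

End Interlacing.

(** * Newton's identities and interpolation *)

Definition psum (F : comNzRingType) n (x : nat -> F) j := \sum_(i < n) x i ^+ j.

(* [rcoef n x m] is the coefficient of degree [n - m] of [rpoly n x], see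
   [coef_rpolyE]; this indexing is stable under adding a root. *)
Fixpoint rcoef (F : comNzRingType) n (x : nat -> F) m : F :=
  if n is n'.+1 then
    rcoef n' x m - x n' * (if m is m'.+1 then rcoef n' x m' else 0)
  else (m == 0%N)%:R.

Section Newton.
Variable F : rcfType.
Implicit Types (x y : nat -> F).

Lemma rcoef_gt n x m : (n < m)%N -> rcoef n x m = 0.
Proof.
elim: n m => [|n IH] [|m] //=; rewrite ltnS => nm.
by rewrite !IH ?mulr0 ?subr0 // ltnW.
Qed.

Lemma rcoef0 n x : rcoef n x 0 = 1.
Proof. by elim: n => //= n ->; rewrite mulr0 subr0. Qed.

Lemma coef_rpolyE n x m : (m <= n)%N -> (rpoly n x)`_(n - m) = rcoef n x m.
Proof.
elim: n m => [|n IH] m; first by rewrite leqn0 => /eqP->; rewrite /rpoly big_ord0 coef1.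
rewrite rpolyS mulrBr coefB coefMX mulrC mul_polyC coefZ => mn /=.
case: m mn => [|m] mn.
  rewrite subn0 /= rcoef0 mulr0 subr0 coef_rpoly.
  by rewrite nth_default ?mulr0 ?subr0 // size_rpoly.
rewrite subSS IH //; case: (ltnP m n) => mn'; last first.
  have -> : m = n by lia.
  by rewrite subnn (rcoef_gt x (ltnSn n)).
by rewrite subn_eq0 leqNgt mn' /= -(IH m.+1 mn') subnS.
Qed.

(** Induction on the number of roots. As [rcoef] vanishes beyond the degree, one identity covers [m]
    below and above [n]. *)
Lemma newton n x m :
  \sum_(j < m) rcoef n x j * psum n x (m - j) + m%:R * rcoef n x m = 0.
Proof.
elim: n m => [|n IH] m.
  rewrite big1 ?add0r => [|j _]; last by rewrite /psum big_ord0 mulr0.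
  by case: m => [|m] /=; rewrite ?mul0r ?mulr0.
set r := x n; pose c' j := if j is j'.+1 then rcoef n x j' else 0.
have E j : rcoef n.+1 x j = rcoef n x j - r * c' j by [].
(* The terms containing the powers of the new root [r] telescope. *)
have T : forall M, \sum_(j < M.+1) (rcoef n x j - r * c' j) * r ^+ (M.+1 - j)
    = r * rcoef n x M.
  elim=> [|M IHM]; first by rewrite big_ord1 /= subn0 expr1; ring.
  rewrite big_ord_recr /= subSnn expr1.
  rewrite (eq_bigr (fun j : 'I_M.+1 =>
    r * ((rcoef n x j - r * c' j) * r ^+ (M.+1 - j)))).
    by rewrite -big_distrr /= IHM; ring.
  by move=> j _; rewrite (subSn (ltnW (ltn_ord j))) exprS; ring.
case: m => [|M]; first by rewrite big_ord0 mul0r addr0.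
rewrite (eq_bigr (fun j : 'I_M.+1 => rcoef n x j * psum n x (M.+1 - j)
    - r * (c' j * psum n x (M.+1 - j))
    + (rcoef n x j - r * c' j) * r ^+ (M.+1 - j))); last first.
  by move=> j _; rewrite E /psum big_ord_recr /=; ring.
rewrite big_split /= big_split /= sumrN -big_distrr /= T.
have -> : \sum_(j < M.+1) c' j * psum n x (M.+1 - j) =
    \sum_(j < M) rcoef n x j * psum n x (M - j).
  rewrite big_ord_recl /= mul0r add0r; apply: eq_bigr => j _.
  by rewrite /bump /= add1n subSS.
have h1 := IH M.+1; have h2 := IH M.
rewrite /= -/r; set A := \sum_(j < M.+1) _ in h1 *; set B := \sum_(j < M) _ in h2 *.
have -> : A = - (M.+1%:R * rcoef n x M.+1) by apply/eqP; rewrite -addr_eq0 h1.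
have -> : B = - (M%:R * rcoef n x M) by apply/eqP; rewrite -addr_eq0 h2.
by rewrite -(natr1 M); ring.
Qed.

(** In the difference of the two Newton identities of order [m.+1], only the first and the last
    terms survive. *)
Lemma psum_rcoef_diff n x y m :
  (forall j, (0 < j)%N -> (j < m.+1)%N -> psum n x j = psum n y j) ->
  (forall j, (j < m.+1)%N -> rcoef n x j = rcoef n y j) ->
  psum n x m.+1 - psum n y m.+1 = - (m.+1%:R * (rcoef n x m.+1 - rcoef n y m.+1)).
Proof.
move=> ps cs; have hx := newton n x m.+1; have hy := newton n y m.+1.
rewrite big_ord_recl /= rcoef0 mul1r subn0 in hx.
rewrite big_ord_recl /= rcoef0 mul1r subn0 in hy.
have E : \sum_(i < m) rcoef n x (bump 0 i) * psum n x (m.+1 - bump 0 i) =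
    \sum_(i < m) rcoef n y (bump 0 i) * psum n y (m.+1 - bump 0 i).
  apply: eq_bigr => i _; rewrite /bump /= add1n cs ?ltnS ?ltn_ord //.
  by rewrite ps // subSS; have := ltn_ord i; lia.
rewrite E in hx; move: hx hy; set S := \sum_(i < m) _.
move=> /eqP; rewrite -addrA addr_eq0 => /eqP-> /eqP; rewrite -addrA addr_eq0 => /eqP->.
ring.
Qed.

Lemma rcoef_of_psum n x y M :
  (forall j, (0 < j)%N -> (j < M)%N -> psum n x j = psum n y j) ->
  forall j, (j < M)%N -> rcoef n x j = rcoef n y j.
Proof.
move=> ps; elim/ltn_ind => -[|j] IH jM; first by rewrite !rcoef0.
have := @psum_rcoef_diff n x y j; rewrite ps // subrr => H.
have /eqP : 0 = - (j.+1%:R * (rcoef n x j.+1 - rcoef n y j.+1)).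
  apply: H => i; first by move=> i0 ij; apply: ps => //; lia.
  by move=> ij; apply: IH => //; lia.
by rewrite eq_sym oppr_eq0 mulf_eq0 pnatr_eq0 /= subr_eq0 => /eqP.
Qed.

Lemma psum_of_rcoef n x y M :
  (forall j, (j < M)%N -> rcoef n x j = rcoef n y j) ->
  forall j, (0 < j)%N -> (j < M)%N -> psum n x j = psum n y j.
Proof.
move=> cs; elim/ltn_ind => -[//|j] IH _ jM.
apply/eqP; rewrite -subr_eq0 psum_rcoef_diff; first by rewrite cs // subrr mulr0 oppr0.
  by move=> i i0 ij; apply: IH => //; lia.
by move=> i ij; apply: cs; lia.
Qed.

Lemma psum_shift k (y c : nat -> F) d : rpoly k c = rpoly k y - d%:P ->
  forall j, (0 < j)%N -> (j < k)%N -> psum k c j = psum k y j.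
Proof.
move=> E; apply: psum_of_rcoef => j jk.
rewrite -!coef_rpolyE ?(ltnW jk) // E coefB coefC subn_eq0 leqNgt jk /=.
by rewrite subr0.
Qed.

(** The coefficients of degrees 0 and 1 are those of orders [k.+1] and [k] in [rcoef], out of reach
    of the power sums of order below [k]. *)
Lemma psum_affine k (x c : nat -> F) al be :
  rpoly k.+1 c = rpoly k.+1 x - al *: 'X + be%:P ->
  forall j, (0 < j)%N -> (j < k)%N -> psum k.+1 c j = psum k.+1 x j.
Proof.
move=> E; apply: psum_of_rcoef => j jk.
have jk' : (j <= k.+1)%N by lia.
rewrite -!(coef_rpolyE _ jk') E coefD coefB coefZ coefC coefX.
have -> : (k.+1 - j == 0)%N = false by lia.
have -> : (k.+1 - j == 1)%N = false by lia.
by rewrite /= mulr0 subr0 addr0.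
Qed.

Lemma psum_top_affine k (x c : nat -> F) al be : (0 < k)%N ->
  rpoly k.+1 c = rpoly k.+1 x - al *: 'X + be%:P ->
  psum k.+1 c k = psum k.+1 x k + k%:R * al.
Proof.
case: k => // k _ E; apply/eqP; rewrite addrC -subr_eq; apply/eqP.
have ps := psum_affine E; rewrite psum_rcoef_diff //; last exact: rcoef_of_psum.
rewrite -!coef_rpolyE // E coefD coefB coefZ coefC coefX.
have -> : (k.+2 - k.+1 = 1)%N by lia.
by rewrite /=; ring.
Qed.

Lemma rpoly_affine k (x a : nat -> F) : (0 < k)%N ->
  (forall j, (0 < j)%N -> (j < k)%N -> psum k.+1 a j = psum k.+1 x j) ->
  exists be, rpoly k.+1 a =
    rpoly k.+1 x - ((psum k.+1 a k - psum k.+1 x k) / k%:R) *: 'X + be%:P.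
Proof.
move=> k0 ps; exists ((rpoly k.+1 a)`_0 - (rpoly k.+1 x)`_0).
have cs := rcoef_of_psum ps; apply/polyP => i.
rewrite coefD coefB coefZ coefC coefX; case: i => [|[|i]] /=.
- by rewrite mulr0 subr0; ring.
- have c1 (z : nat -> F) : (rpoly k.+1 z)`_1 = rcoef k.+1 z k.
    by rewrite -coef_rpolyE // subSnn.
  rewrite !c1 addr0 mulr1; case: k k0 ps cs c1 => // k _ ps cs _.
  rewrite psum_rcoef_diff //; have : k.+1%:R != 0 :> F by rewrite pnatr_eq0.
  by move: (k.+1%:R) => w w0; field.
- rewrite mulr0 subr0 addr0; case: (leqP i.+2 k.+1) => ik; last first.
    by rewrite !nth_default // size_rpoly.
  have -> : i.+2 = (k.+1 - (k.+1 - i.+2))%N by lia.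
  by rewrite !coef_rpolyE ?leq_subr //; apply: cs; lia.
Qed.

End Newton.

Section Interpolation.
Variable R : realType.
Implicit Types (y c z : nat -> R) (f : R -> R).

(** The consequence of f^(k) >= 0 on which the comparison of sums rests. Off the nodes, [w] is the
    k-th divided difference of [f] at the nodes and [t]. *)
Definition kconvex k f := forall z, sdec k z ->
  exists2 p : {poly R}, (size p <= k)%N &
    forall t, exists2 w, 0 <= w & f t = p.[t] + w * (rpoly k z).[t].

Lemma rsum_poly n k y c (p : {poly R}) : (size p <= k)%N ->
  (forall j, (0 < j)%N -> (j < k)%N -> psum n c j = psum n y j) ->
  \sum_(i < n) p.[c i] = \sum_(i < n) p.[y i].
Proof.
move=> sp ps; pose E z := \sum_(j < size p) p`_j * psum n z j.
have EE z : \sum_(i < n) p.[z i] = E z.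
  under eq_bigr do rewrite horner_coef.
  by rewrite exchange_big; apply: eq_bigr => j _; rewrite /psum big_distrr.
rewrite !EE; apply: eq_bigr => -[[|j] jp] _ /=.
  by congr (_ * _); apply: eq_bigr => i _; rewrite !expr0.
by rewrite ps // (leq_trans jp sp).
Qed.

(* Interpolate [f] at the roots of [rpoly k y - d / 2], which has opposite signs
   at the roots of [rpoly k y] and of [rpoly k y - d]. *)
Lemma rsum_shift_le k f y c d : kconvex k f -> dec k y -> dec k c -> 0 < d ->
  rpoly k c = rpoly k y - d%:P -> \sum_(i < k) f (y i) <= \sum_(i < k) f (c i).
Proof.
move=> fk yd cd d0 E.
have [|z [zs Ez]] := @shift_between _ k y c d (d / 2) yd cd E; first by apply/andP; split; lra.
have [p sp pf] := fk z zs.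
apply: (@le_trans _ _ (\sum_(i < k) p.[y i])).
  apply: ler_sum => i _; have [w w0 ->] := pf (y i).
  rewrite (rpoly_shift _ Ez) horner_rpoly_root //; nra.
rewrite -(rsum_poly sp (psum_shift E)).
apply: ler_sum => i _; have [w w0 ->] := pf (c i).
have := rpoly_shift (c i) E; rewrite (rpoly_shift _ Ez) horner_rpoly_root // => H.
nra.
Qed.

End Interpolation.

(** * The order on a fibre *)

Section Skip.
Variable R : realType.
Implicit Types (x y c : nat -> R).

Definition skip l x i := x (bump l i).

Lemma rpoly_skip k x l : (l < k.+1)%N ->
  rpoly k.+1 x = ('X - (x l)%:P) * rpoly k (skip l x).
Proof. by move=> lk; rewrite /rpoly (bigD1_ord (Ordinal lk)). Qed.

Lemma rsum_skip k x l (f : R -> R) : (l < k.+1)%N ->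
  \sum_(i < k.+1) f (x i) = f (x l) + \sum_(i < k) f (skip l x i).
Proof. by move=> lk; rewrite (bigD1_ord (Ordinal lk)). Qed.

Lemma skip_dec k x l : dec k.+1 x -> dec k (skip l x).
Proof. by move=> xd i j ij jk; apply: xd; rewrite /bump; lia. Qed.

End Skip.

Section Fibre.
Variables (R : realType) (k : nat) (s : nat -> R) (Phi : (R -> R) -> Prop).
Implicit Types (x y a b c : nat -> R).

Let n := k.+1.

(** [Phi] stands for the functions with nonnegative k-th derivative. What the section uses of them
    is interpolation, continuity and the comparison of ends, the three hypotheses on [Phi] below. *)
Definition maj a b := forall f, Phi f -> \sum_(i < n) f (b i) <= \sum_(i < n) f (a i).

(* For points of the fibre with ordered k-th power sums this is equivalent to
   k-majorization, see [maj_of_ends]. *)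
Definition ends_le x y :=
  x 0%N <= y 0%N /\ (-1) ^+ k.+1 * x k <= (-1) ^+ k.+1 * y k.

Definition fibre x :=
  dec n x /\ forall j, (0 < j)%N -> (j < k)%N -> psum n x j = s j.

Definition lam x := psum n x k.

Hypothesis k_ge3 : (3 <= k)%N.
Hypothesis Phi_kconvex : forall f, Phi f -> kconvex k f.
Hypothesis Phi_cont : forall f, Phi f -> continuous f.
Hypothesis maj_ends : forall a b, dec n a -> dec n b -> maj a b -> ends_le b a.

Let k_gt0 : (0 < k)%N. Proof. exact: leq_trans k_ge3. Qed.
Let kR_gt0 : 0 < k%:R :> R. Proof. by rewrite ltr0n. Qed.

(** The second power sum is fixed because [k >= 3], and |t| <= 1 + t^2. *)
Lemma fibre_bounded x i : fibre x -> (i < n)%N -> `|x i| <= 1 + s 2.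
Proof.
move=> [_ xs] lin; rewrite -xs // /psum (bigD1 (Ordinal lin)) //=.
have : 0 <= \sum_(j < n | j != Ordinal lin) x j ^+ 2.
  by apply: sumr_ge0 => j _; apply: sqr_ge0.
move: (\sum_(_ < _ | _) _) => S S0; rewrite ler_norml; apply/andP; split; nra.
Qed.

Lemma continuous_exp j : continuous (fun t : R => t ^+ j).
Proof. by move=> t; apply: exprn_continuous. Qed.

Lemma cvg_psum u x j : vcvg n u x -> psum n (u m) j @[m --> \oo] --> psum n x j.
Proof. exact: cvg_rsum (@continuous_exp j). Qed.

Lemma fibre_closed u x : (forall m, fibre (u m)) -> vcvg n u x -> fibre x.
Proof.
move=> uS ux; split; first by apply: vcvg_dec ux => m; case: (uS m).
move=> j j0 jk; apply: (@cvg_unique _ _ ((fun m => psum n (u m) j) @ \oo)) => //.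
  exact: cvg_psum.
have -> : (fun m => psum n (u m) j) = (fun=> s j).
  by apply/funext => m; case: (uS m) => _ ->.
exact: cvg_cst.
Qed.

Lemma ends_le_closed u v x y : (forall m, ends_le (u m) (v m)) ->
  vcvg n u x -> vcvg n v y -> ends_le x y.
Proof.
move=> uv ux vy; split.
  apply: (ler_cvg_to (ux 0%N isT) (vy 0%N isT)); near=> m; exact: (uv m).1.
have h (z : nat -> R) w : vcvg n w z -> (-1) ^+ k.+1 * w m k @[m --> \oo] --> (-1) ^+ k.+1 * z k.
  by move=> wz; apply: cvgM; [exact: cvg_cst|exact: wz].
apply: (ler_cvg_to (h _ _ ux) (h _ _ vy)); near=> m; exact: (uv m).2.
Unshelve. all: by end_near. Qed.

Lemma vcvg_cst x : vcvg n (fun=> x) x.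
Proof. by move=> i _; apply: cvg_cst. Qed.

Lemma maj_closed u x b : (forall m, maj (u m) b) -> vcvg n u x -> maj x b.
Proof.
move=> um ux f Pf.
apply: (ler_cvg_to (cvg_rsum (Phi_cont Pf) (@vcvg_cst b)) (cvg_rsum (Phi_cont Pf) ux)).
by near=> m; apply: um.
Unshelve. all: by end_near. Qed.

(** A maximising sequence has a convergent subsequence by boundedness of the fibre. This serves once
    for [lam] and once for the first coordinate. *)
Lemma fibre_attain (Q : (nat -> R) -> Prop) (h : (nat -> R) -> R) C x0 : Q x0 ->
  (forall x, Q x -> fibre x) ->
  (forall u x, (forall m, Q (u m)) -> vcvg n u x -> Q x) ->
  (forall u x, vcvg n u x -> h (u m) @[m --> \oo] --> h x) ->
  (forall x, Q x -> h x <= C) ->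
  exists2 x, Q x & forall y, Q y -> h y <= h x.
Proof.
move=> Q0 QS Qc hc hC.
have sH : has_sup [set h x | x in Q].
  by split; [exists (h x0), x0 | exists C => _ [x Qx <-]; apply: hC].
set M := sup [set h x | x in Q].
have /choice[u uP] : forall m : nat, exists x, Q x /\ M - m.+1%:R^-1 < h x.
  move=> m; have [|_ [x Qx <-] hx] := @sup_adherent _ _ (m.+1%:R^-1) _ sH.
    by rewrite invr_gt0 ltr0Sn.
  by exists x.
have [|f [x [fm fx]]] := @bounded_vcvg _ n u (1 + s 2).
  by move=> m i; apply: fibre_bounded; apply: QS; case: (uP m).
have Qx : Q x by apply: Qc fx => m; case: (uP (f m)).
exists x => // y Qy; apply: (@le_trans _ _ M).
  by apply: ub_le_sup; [case: sH | exists y].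
have H : (M - m.+1%:R^-1) @[m --> \oo] --> M - 0.
  by apply: cvgB; [exact: cvg_cst | exact: cvg_harmonic].
rewrite -[M]subr0; apply: (ler_cvg_to H (hc _ _ fx)).
near=> m; apply: le_trans (ltW (uP (f m)).2).
rewrite lerD2l lerN2 lef_pV2 ?posrE ?ltr0Sn // ler_nat ltnS; exact: fm.
Unshelve. all: by end_near. Qed.

Lemma fibre_affine x a : fibre x -> fibre a ->
  exists be, rpoly n a = rpoly n x - ((lam a - lam x) / k%:R) *: 'X + be%:P.
Proof.
move=> [_ xs] [_ as_]; apply: rpoly_affine => // j j0 jk.
by rewrite xs // as_.
Qed.

(** On one level the polynomials differ by a constant, and [interlace] applies at ranks 0 and [k].
    The sign (-1)^(k+1) absorbs the parity of the last rank, so the two quantities of [ends_le] vary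
    in opposite directions along a level. *)
Lemma level_cases x y : fibre x -> fibre y -> lam x = lam y ->
  [\/ forall i, (i < n)%N -> x i = y i,
      x 0%N < y 0%N /\ (-1) ^+ k.+1 * y k < (-1) ^+ k.+1 * x k |
      y 0%N < x 0%N /\ (-1) ^+ k.+1 * x k < (-1) ^+ k.+1 * y k].
Proof.
move=> xS yS lxy; have [be] := fibre_affine xS yS.
rewrite lxy subrr mul0r scale0r subr0 => E.
have sgnk z w : (if odd k then z k < w k else w k < z k) ->
    (-1) ^+ k.+1 * z k < (-1) ^+ k.+1 * w k :> R.
  case: (boolP (odd k)) => ok; first by rewrite even_signr /= ?ok // !mul1r.
  by rewrite odd_signr // !mulN1r ltrN2.
have [be0|be0|be0] := ltgtP be 0.
- have E' : rpoly n y = rpoly n x - (- be)%:P by rewrite polyCN opprK.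
  have il := interlace xS.1 yS.1 _ E'.
  apply: Or32; split; first by apply: (il _ 0%N) => //; lra.
  by apply: sgnk; apply: il => //; lra.
- have E' : rpoly n x = rpoly n y - be%:P by rewrite E addrK.
  have il := interlace yS.1 xS.1 be0 E'.
  by apply: Or33; split; [exact: (il 0%N) | apply: sgnk; apply: il].
- apply: Or31; apply: rpoly_inj; [exact: xS.1 | exact: yS.1 |].
  by rewrite E be0 addr0.
Qed.

Lemma level_eq x y : fibre x -> fibre y -> lam x = lam y -> ends_le x y ->
  forall i, (i < n)%N -> x i = y i.
Proof.
by move=> xS yS lxy [h1 h2]; case: (level_cases xS yS lxy) => // -[h3 h4]; lra.
Qed.

(** * Moves that fix one root *)

(** Division by the factor of the fixed root turns the move into the subtraction of a constant, to
    which [rsum_shift_le] applies. The formula for sums lets [common_root] also compare [x'] with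
    its target. *)
Lemma move_root x l c d : fibre x -> (l < n)%N -> dec k c -> 0 < d ->
  rpoly k c = rpoly k (skip l x) - d%:P ->
  exists x', [/\ fibre x', rpoly n x' = rpoly n x - d *: ('X - (x l)%:P),
    lam x' = lam x + k%:R * d, maj x' x &
    forall f : R -> R, \sum_(i < n) f (x' i) = f (x l) + \sum_(i < k) f (c i)].
Proof.
move=> xS ln cd d0 E.
pose v i := if i is i'.+1 then c i' else x l.
have [x' [x'd Ev fv]] := sort_vector n v.
have E' : rpoly n x' = rpoly n x - d *: ('X - (x l)%:P).
  rewrite Ev /rpoly big_ord_recl /= -/(rpoly k c) E -/(rpoly n x) (rpoly_skip _ ln).
  by rewrite mulrBr [_ * d%:P]mulrC mul_polyC.
have E2 : rpoly n x' = rpoly n x - d *: 'X + (d * x l)%:P.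
  by rewrite E' scalerBr opprB addrA addrAC polyCM mul_polyC.
have fx' (f : R -> R) : \sum_(i < n) f (x' i) = f (x l) + \sum_(i < k) f (c i).
  by rewrite (fv f) big_ord_recl.
exists x'; split => //.
- by split => // j j0 jk; rewrite (psum_affine E2) // xS.2.
- exact: psum_top_affine E2.
- move=> f Pf; rewrite (fx' f) (rsum_skip _ f ln) lerD2l.
  exact: (rsum_shift_le (Phi_kconvex Pf) (skip_dec l xS.1) cd d0 E).
Qed.

(** After division by the common factor the quotients differ by the constant [al]. Subtracting only
    [d < al], with [d] dictated by the level [L], gives by [shift_between] a real-rooted polynomial
    comparable with both. *)
Lemma common_root x a l l' L : fibre x -> fibre a -> (l < n)%N -> (l' < n)%N ->
  x l = a l' -> lam x < L < lam a ->
  exists x', [/\ fibre x', lam x' = L, maj x' x & maj a x'].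
Proof.
move=> xS aS ln ln' xa /andP[xL La].
have [be E] := fibre_affine xS aS; set al := (lam a - lam x) / k%:R in E.
have al0 : 0 < al by rewrite divr_gt0 // subr_gt0 (lt_trans xL).
have beE : be = al * x l.
  have := congr1 (horner^~ (x l)) E; rewrite /= !hornerE horner_rpoly_root //.
  by rewrite xa horner_rpoly_root //; lra.
have Es : rpoly k (skip l' a) = rpoly k (skip l x) - al%:P.
  apply: (@mulfI _ ('X - (x l)%:P)); first by rewrite polyXsubC_eq0.
  rewrite [in LHS]xa -rpoly_skip // E beE mulrBr -rpoly_skip // -addrA; congr (_ + _).
  by rewrite [_ * al%:P]mulrC mul_polyC scalerBr opprB addrC polyCM mul_polyC.
pose d := (L - lam x) / k%:R.
have d0 : 0 < d by rewrite divr_gt0 // subr_gt0.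
have dal : d < al by rewrite ltr_pM2r ?invr_gt0 // ltrD2r.
have [|c [cs Ec]] := shift_between (skip_dec l xS.1) (skip_dec l' aS.1) Es (k' := d).
  by rewrite d0.
have [x' [x'S _ lx' mx fx']] := move_root xS ln (sdec_dec cs) d0 Ec.
exists x'; split => //.
  by rewrite lx' /d mulrCA mulfV ?gt_eqF // mulr1; ring.
move=> f Pf; rewrite (fx' f) (rsum_skip _ f ln') xa lerD2l.
apply: (rsum_shift_le (Phi_kconvex Pf) (sdec_dec cs) (skip_dec l' aS.1) (d := al - d)).
  by rewrite subr_gt0.
by rewrite Es Ec polyCB; ring.
Qed.

(* Removing the root just before the first collision of odd rank leaves a
   polynomial without such collisions; [x] has no later collision of even rank
   because its k-th power sum is not maximal. *)
Lemma exists_free_root x a : fibre x -> fibre a -> lam x < lam a ->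
  exists2 l, (l < n)%N &
    forall i, odd i -> (i.+1 < k)%N -> skip l x i.+1 < skip l x i.
Proof.
move=> xS aS lxa; have [be E] := fibre_affine xS aS.
have al0 : 0 < (lam a - lam x) / k%:R by rewrite divr_gt0 // subr_gt0.
have noc := collision_maximal xS.1 aS.1 E al0.
have slt i : (i.+1 < n)%N -> x i != x i.+1 -> x i.+1 < x i.
  by move=> lin ne; rewrite lt_neqAle eq_sym ne xS.1.
pose C o := [&& odd o, (o.+1 < n)%N & x o == x o.+1].
have [exC|noC] := pselect (exists o, C o); last first.
  exists k => // i oi lik.
  have ik : (i < k)%N by exact: ltnW.
  rewrite /skip /bump (leqNgt k i) ik (leqNgt k i.+1) lik !add0n.
  apply: slt; first exact: ltnW.
  by apply/negP => xi; apply: noC; exists i; rewrite /C oi xi /= ltnS ltnW.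
case: (ex_minnP exC) => o /and3P[oo on /eqP xo] omin.
have o0 : (0 < o)%N by case: (o) oo.
exists o.-1; first by move: o0 on; clear; lia.
move=> i oi lik; rewrite /skip.
have [io|oi'] := ltnP i o.-1.
  have bi : bump o.-1 i = i by rewrite /bump leqNgt io.
  have lin : (i.+1 < n)%N by exact: ltnW.
  rewrite bi; apply: (@le_lt_trans _ _ (x i.+1)).
    by apply: xS.1; rewrite /bump; move: lik; rewrite /n; clear; lia.
  apply: slt => //; apply/negP => xi.
  have : C i by rewrite /C oi lin xi.
  by move/omin; move: io; clear; lia.
(* Beyond the removed root, the odd rank [i] of the quotient is the even rank [i.+1] of [x], greater
   than [o], where [noc] excludes a collision. *)
have bi : bump o.-1 i = i.+1 by rewrite /bump oi'.
have bi1 : bump o.-1 i.+1 = i.+2 by rewrite /bump (leq_trans oi') ?leqnSn.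
have lin : (i.+2 < n)%N by [].
rewrite bi bi1; apply: slt => //; apply/eqP => xi.
apply: (noc o i.+1) => //=; first by rewrite oi.
by move: oi' o0 oo oi; clear; lia.
Qed.

(** The points obtained by the moves of size [dd m] tend to [x], so the strict inequalities at both
    ends persist for a small move. *)
Lemma interior_step x a e : fibre x -> fibre a -> lam x < lam a ->
  x 0%N < a 0%N -> (-1) ^+ k.+1 * x k < (-1) ^+ k.+1 * a k -> 0 < e ->
  exists x', [/\ fibre x', lam x < lam x' <= lam x + e, maj x' x & ends_le x' a].
Proof.
move=> xS aS lxa h0 hk e0.
have [l ln gap] := exists_free_root xS aS lxa.
have [d0 d00 D] := shift_odd_gaps k_gt0 (skip_dec l xS.1) gap.
(* The first bound keeps the moved polynomial real-rooted, the second keeps the growth of [lam]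
   within [e]. *)
pose d1 := Num.min d0 (e / k%:R).
have d10 : 0 < d1 by rewrite lt_min d00 divr_gt0.
pose dd (m : nat) := d1 * m.+1%:R^-1.
have ddP m : 0 < dd m <= d1.
  rewrite mulr_gt0 ?invr_gt0 ?ltr0Sn //=; apply: ler_piMr; first exact: ltW.
  by rewrite invf_le1 ?ltr0Sn // ler1n.
have /choice[u uP] : forall m, exists x', [/\ fibre x',
    rpoly n x' = rpoly n x - dd m *: ('X - (x l)%:P),
    lam x' = lam x + k%:R * dd m & maj x' x].
  move=> m; have /andP[p0 p1] := ddP m.
  have [|c [cs Ec]] := D (dd m).
    by rewrite p0 (le_trans p1) // ge_min lexx.
  by have [x' [? ? ? ? _]] := move_root xS ln (sdec_dec cs) p0 Ec; exists x'.
have dd0 : dd m @[m --> \oo] --> (0 : R).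
  rewrite -(mulr0 d1); apply: cvgM; [exact: cvg_cst | exact: cvg_harmonic].
have ux : vcvg n u x.
  apply: (@vcvg_rpoly_dec _ _ _ _ (1 + s 2)).
  - by move=> m i; apply: fibre_bounded; case: (uP m).
  - by move=> m; case: (uP m) => -[].
  - exact: xS.1.
  - move=> t; have -> : (fun m => (rpoly n (u m)).[t]) =
        (fun m => (rpoly n x).[t] - dd m * (t - x l)).
      by apply/funext => m; case: (uP m) => _ -> _ _; rewrite !hornerE.
    rewrite -[X in _ --> X]subr0; apply: cvgB; first exact: cvg_cst.
    by rewrite -(mul0r (t - x l)); apply: cvgM => //; exact: cvg_cst.
have ukx : (-1) ^+ k.+1 * u m k @[m --> \oo] --> (-1) ^+ k.+1 * x k.
  by apply: cvgM; [exact: cvg_cst | exact: ux].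
have [N1 _ N1P] := cvgr_lt _ (ux 0%N isT) _ h0.
have [N2 _ N2P] := cvgr_lt _ ukx _ hk.
pose N := maxn N1 N2; have [uS _ lu mu] := uP N.
exists (u N); split => //.
  have /andP[p0 p1] := ddP N; rewrite lu ltrDl mulr_gt0 //= lerD2l.
  rewrite mulrC -ler_pdivlMr //; apply: le_trans p1 _.
  by rewrite ge_min lexx orbT.
by split; apply/ltW; [apply: N1P | apply: N2P]; rewrite /= ?leq_maxl ?leq_maxr.
Qed.

(** If [x] and [a] share an end, there is no room at that end and the move fixes this common root;
    otherwise a small free move stays below [a]. *)
Lemma step_up x a L : fibre x -> fibre a -> ends_le x a -> lam x < L <= lam a ->
  exists x', [/\ fibre x', lam x < lam x' <= L, maj x' x & ends_le x' a].
Proof.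
move=> xS aS [h0 hk] /andP[xL La].
have common l : (l < n)%N -> x l = a l -> exists x',
    [/\ fibre x', lam x < lam x' <= L, maj x' x & ends_le x' a].
  (* The midpoint lies strictly below [lam a] even when [L = lam a]. *)
  move=> ln xa; have [|x' [x'S lx' m1 m2]] := common_root xS aS ln ln xa (L := (lam x + L) / 2).
    by apply/andP; split; lra.
  exists x'; split => //; first by rewrite lx'; apply/andP; split; lra.
  exact: maj_ends aS.1 x'S.1 m2.
move: h0; rewrite le_eqVlt => /predU1P[/common|h0]; first by apply.
move: hk; rewrite le_eqVlt => /predU1P[hk|hk].
  apply: (common k) => //; apply: (mulfI _ hk); by rewrite signr_eq0.
have [||x' [x'S lx' m1 m2]] := interior_step xS aS _ h0 hk (e := L - lam x).
- exact: lt_le_trans xL La.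
- by rewrite subr_gt0.
- by exists x'; split => //; rewrite addrC subrK in lx'.
Qed.

(** * Climbing to a given level, and the path *)

(** Maximise [lam], up to [L], among the points below [a] that majorize [b]; at a maximum short of
    [L], [step_up] would give a better point. *)
Lemma intermediate b a L : fibre b -> fibre a -> ends_le b a -> lam b <= L <= lam a ->
  exists x, [/\ fibre x, ends_le b x, ends_le x a, lam x = L & maj x b].
Proof.
move=> bS aS ba /andP[bL La].
have [||||| x [xS xa mxb xL] xmax] := @fibre_attain
  (fun x => [/\ fibre x, ends_le x a, maj x b & lam x <= L]) lam L b.
- by split.
- by move=> x [].
- move=> u x uP ux; split.
  + by apply: fibre_closed ux => m; case: (uP m).
  + by apply: ends_le_closed ux (@vcvg_cst a) => m; case: (uP m).
  + by apply: maj_closed ux => m; case: (uP m).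
  + apply: (ler_cvg_to (cvg_psum ux) (cvg_cst L)); near=> m; by case: (uP m).
- by move=> u x; apply: cvg_psum.
- by move=> x [].
have bx := maj_ends xS.1 bS.1 mxb.
exists x; split => //; apply/eqP; rewrite eq_le xL /= leNgt; apply/negP => xL'.
have [|x' [x'S /andP[lx1 lx2] m x'a]] := step_up xS aS xa (L := L).
  by rewrite xL'.
have : lam x' <= lam x.
  by apply: xmax; split => // f Pf; apply: le_trans (mxb f Pf) (m f Pf).
by rewrite leNgt lx1.
Unshelve. all: by end_near. Qed.

(** A climb from [b] below [a] to the level of [a] can only end at [a], by [level_eq]. *)
Lemma maj_of_ends b a : fibre b -> fibre a -> ends_le b a -> lam b <= lam a ->
  maj a b.
Proof.
move=> bS aS ba lba.
have [|x [xS _ xa lx mx]] := intermediate bS aS ba (L := lam a); first by rewrite lba lexx.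
move=> f Pf; apply: le_trans (mx f Pf) _; rewrite le_eqVlt; apply/orP; left; apply/eqP.
by apply: eq_bigr => i _; rewrite (level_eq xS aS lx xa).
Qed.

(* On each level [lam = L] inside the order interval [b, a] the path takes the
   point with the largest first coordinate. *)
Theorem monotone_path b a : fibre b -> fibre a -> ends_le b a -> lam b <= lam a ->
  exists p : R -> nat -> R, [/\
    forall t, 0 <= t <= 1 -> fibre (p t),
    forall i, (i < n)%N -> forall t, 0 <= t <= 1 -> forall e, 0 < e ->
      exists2 d, 0 < d & forall t', 0 <= t' <= 1 -> `|t' - t| < d ->
        `|p t' i - p t i| < e,
    forall i, (i < n)%N -> p 0 i = b i,
    forall i, (i < n)%N -> p 1 i = a i &
    forall t0 t1, 0 <= t0 <= 1 -> 0 <= t1 <= 1 -> t0 <= t1 -> maj (p t1) (p t0)].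
Proof.
move=> bS aS ba lba.
pose L t := lam b + t * (lam a - lam b).
pose Q t x := [/\ fibre x, ends_le b x, ends_le x a & lam x = L t].
have LP t : 0 <= t <= 1 -> lam b <= L t <= lam a.
  by move=> /andP[t0 t1]; rewrite /L; apply/andP; split; nra.
have Lmono t t' : t <= t' -> L t <= L t'.
  by move=> tt'; rewrite /L lerD2l ler_wpM2r // subr_ge0.
(* The levels of the points [u m] may vary, as the proof of continuity requires. *)
have Qclosed t u x : (forall m, fibre (u m) /\ ends_le b (u m) /\ ends_le (u m) a) ->
    lam (u m) @[m --> \oo] --> L t -> vcvg n u x -> Q t x.
  move=> uP ul ux; split.
  - by apply: fibre_closed ux => m; case: (uP m).
  - by apply: ends_le_closed (@vcvg_cst b) ux => m; case: (uP m) => _ [].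
  - by apply: ends_le_closed ux (@vcvg_cst a) => m; case: (uP m) => _ [].
  - by apply: (@cvg_unique _ _ ((fun m => lam (u m)) @ \oo)) => //; apply: cvg_psum.
have /choice[p pP] : forall t, exists x, 0 <= t <= 1 ->
    Q t x /\ forall y, Q t y -> y 0%N <= x 0%N.
  move=> t; have [t01|nt] := pselect (0 <= t <= 1); last by exists b.
  have [x0 [x0S bx0 x0a lx0 _]] := intermediate bS aS ba (LP t t01).
  have [||||| x Qx xmax] := @fibre_attain (Q t) (fun x => x 0%N) (a 0%N) x0.
  - by split.
  - by move=> x [].
  - move=> u x uP ux; apply: (Qclosed t u) => // [m|]; first by case: (uP m).
    have -> : (fun m => lam (u m)) = (fun=> L t).
      by apply/funext => m; case: (uP m).
    exact: cvg_cst.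
  - by move=> u x ux; apply: (ux 0%N).
  - by move=> x [_ _ []].
  - by exists x.
have pmono t0 t1 : 0 <= t0 <= 1 -> 0 <= t1 <= 1 -> t0 <= t1 -> ends_le (p t0) (p t1).
  move=> h0 h1 t01; have [[S0 b0 a0 l0] m0] := pP _ h0.
  have [[S1 b1 a1 l1] m1] := pP _ h1; split.
    (* The climb from [p t0] to the level of [t1] stays in the order interval, so its end [y]
       competes with [p t1]. *)
    have [|y [yS [y1 y2] ya ly _]] := intermediate S0 aS a0 (L := L t1).
      by rewrite l0 Lmono //; have /andP[] := LP _ h1.
    apply: (le_trans y1 (m1 y _)); split => //.
    by split; [apply: (le_trans _ y1); case: b0 | apply: (le_trans _ y2); case: b0].
  (* For the last coordinate, [w] lies below [p t1] on the level of [t0], and its first coordinate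
     is at most that of [p t0]. By [level_cases] its signed last coordinate is then at least that of
     [p t0]. *)
  have [|w [wS bw w1 lw _]] := intermediate bS S1 b1 (L := L t0).
    by rewrite l1 Lmono // andbT; have /andP[] := LP _ h0.
  have Qw : Q t0 w.
    by split => //; case: w1 a1 => ? ? [? ?]; split; apply: le_trans; eassumption.
  have w0 := m0 w Qw; apply: le_trans w1.2.
  have [|//|[]|[]] := level_cases wS S0; rewrite ?lw ?l0 //.
  - by move=> /(_ k (ltnSn k)) ->.
  - by move=> _ /ltW.
  - by move=> ?; lra.
exists p; split.
- by move=> t /pP[[]].
- move=> i lin t t01 e e0; apply: contrapT => H.
  have /choice[v vP] : forall m : nat, exists t', [/\ 0 <= t' <= 1,
      `|t' - t| < m.+1%:R^-1 & e <= `|p t' i - p t i|].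
    move=> m; apply: contrapT => H'; apply: H; exists m.+1%:R^-1.
      by rewrite invr_gt0 ltr0Sn.
    move=> t' t'01 t't; rewrite ltNge; apply/negP => ?; apply: H'.
    by exists t'.
  have vt : v m @[m --> \oo] --> t.
    apply/cvgrPdist_lt => d d0.
    have [N _ NP] := cvgr_lt _ (@cvg_harmonic R) _ d0.
    exists N => // m Nm /=; rewrite distrC; case: (vP m) => _ h _.
    by apply: lt_trans h _; apply: NP.
  have [|f [y [fm fy]]] := @bounded_vcvg _ n (fun m => p (v m)) (1 + s 2).
    move=> m j; apply: fibre_bounded; case: (vP m) => /pP[[]] //.
  have [[pS pb pa pl] pm] := pP _ t01.
  have Qy : Q t y.
    apply: (Qclosed t (fun m => p (v (f m)))) => // [m|].
      by case: (vP (f m)) => /pP[[]].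
    have -> : (fun m => lam (p (v (f m)))) = (fun m => L (v (f m))).
      by apply/funext => m; case: (vP (f m)) => /pP[[]].
    apply: cvgD; first exact: cvg_cst.
    by apply: cvgM; [exact: (cvg_subseq fm vt) | exact: cvg_cst].
  have cmp m : ends_le (p (v (f m))) (p t) \/ ends_le (p t) (p (v (f m))).
    case: (vP (f m)) => v01 _ _.
    by case/orP: (le_total (v (f m)) t) => ?; [left|right]; apply: pmono.
  have fyk : (-1) ^+ k.+1 * p (v (f m)) k @[m --> \oo] --> (-1) ^+ k.+1 * y k.
    by apply: cvgM; [exact: cvg_cst | exact: fy].
  (* Distinct points of one level are strictly incomparable, and this would persist near the cluster
     point [y], whereas all points of the path are comparable with [p t]. *)
  have yp : forall j, (j < n)%N -> y j = p t j.
    have [yS _ _ ly] := Qy.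
    have [|//|[h0 hk]|[h0 hk]] := level_cases yS pS; first by rewrite ly pl.
    + have [N1 _ N1P] := cvgr_lt _ (fy 0%N isT) _ h0.
      have [N2 _ N2P] := cvgr_gt _ fyk _ hk.
      have := N1P (maxn N1 N2) (leq_maxl _ _); have := N2P (maxn N1 N2) (leq_maxr _ _).
      by case: (cmp (maxn N1 N2)) => -[] ? ? /= ? ?; lra.
    + have [N1 _ N1P] := cvgr_gt _ (fy 0%N isT) _ h0.
      have [N2 _ N2P] := cvgr_lt _ fyk _ hk.
      have := N1P (maxn N1 N2) (leq_maxl _ _); have := N2P (maxn N1 N2) (leq_maxr _ _).
      by case: (cmp (maxn N1 N2)) => -[] ? ? /= ? ?; lra.
  have /cvgrPdist_lt/(_ _ e0)[N _ /(_ N (leqnn N))] := fy i lin.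
  by rewrite yp //= distrC ltNge; case: (vP (f N)) => _ _ ->.
- move=> i lin; have [|[pS pb pa pl] _] := pP 0; first by rewrite lexx ler01.
  by rewrite -(level_eq bS pS _ pb) // pl /L mul0r addr0.
- move=> i lin; have [|[pS pb pa pl] _] := pP 1; first by rewrite lexx ler01.
  by rewrite (level_eq pS aS _ pa) // pl /L mul1r addrC subrK.
- move=> t0 t1 h0 h1 t01; have [[S0 _ _ l0] _] := pP _ h0.
  have [[S1 _ _ l1] _] := pP _ h1.
  by apply: maj_of_ends => //; [exact: pmono | rewrite l0 l1 Lmono].
Qed.

End Fibre.

(** * Real functions with nonnegative k-th derivative *)

Lemma interpolation (F : rcfType) n (z v : nat -> F) : sdec n z ->
  exists2 p : {poly F}, (size p <= n)%N & forall i, (i < n)%N -> p.[z i] = v i.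
Proof.
elim: n => [|n IH] zs; first by exists 0; rewrite ?size_poly0.
have [|p sp pv] := IH; first by move=> i j ij jn; apply: zs => //; exact: ltnW.
have q0 : (rpoly n z).[z n] != 0.
  apply/eqP => /root_rpoly[i lin zi].
  by have := zs i n lin (ltnSn n); rewrite zi ltxx.
exists (p + ((v n - p.[z n]) / (rpoly n z).[z n]) *: rpoly n z).
  rewrite (leq_trans (size_polyD _ _)) // geq_max (leq_trans sp) //=.
  by rewrite (leq_trans (size_scale_leq _ _)) // size_rpoly.
move=> i; rewrite ltnS leq_eqVlt hornerD hornerZ => /predU1P[->|lin].
  by rewrite divfK // addrC subrK.
by rewrite (horner_rpoly_root z lin) mulr0 addr0 pv.
Qed.

Lemma sort_distinct (F : rcfType) n (v : nat -> F) :
  (forall i j, (i < n)%N -> (j < n)%N -> v i = v j -> i = j) ->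
  exists y, sdec n y /\ forall i, (i < n)%N -> exists2 j, (j < n)%N & y i = v j.
Proof.
move=> vi; pose w := sort (>=%O) (mkseq v n).
have szw : size w = n by rewrite size_sort size_mkseq.
have uw : uniq w.
  by rewrite sort_uniq; apply/mkseq_uniqP => i j; rewrite !inE; apply: vi.
have yd : dec n (nth 0 w).
  apply: dec_step => i lin.
  have /(sortedP 0) : sorted (>=%O) w by apply: sort_sorted => a b; apply: ge_total.
  by apply; rewrite szw.
exists (nth 0 w); split.
  move=> i j ij jn; rewrite lt_neqAle yd ?(ltnW ij) // andbT.
  by rewrite nth_uniq ?szw ?(ltn_trans ij) // gtn_eqF.
move=> i lin; have : nth 0 w i \in w by rewrite mem_nth ?szw.
rewrite mem_sort => /mapP[j]; rewrite mem_iota => /= jn ->; by exists j.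
Qed.

(** Rolle's theorem applied [k] times, each application losing one zero. *)
Lemma rolle_chain k (h : nat -> R -> R) (z : nat -> R) : sdec k.+1 z ->
  (forall j, (j < k)%N -> forall t, derivable_pt_lim (h j) t (h j.+1 t)) ->
  (forall i, (i < k.+1)%N -> h 0%N (z i) = 0) -> exists t, h k t = 0.
Proof.
elim: k h z => [|k IH] h z zs hd h0; first by exists (z 0%N); exact: h0.
have /choice[c cP] : forall i, exists c : R, (i < k.+1)%N ->
    z i.+1 < c < z i /\ h 1%N c = 0.
  move=> i; case: (ltnP i k.+1) => ik; last by exists 0.
  have zi : z i.+1 < z i by apply: zs.
  have /RltP zi' := zi.
  have [|c [Ec [c1 c2]]] := MVT_cor2 (h 0%N) (h 1%N) (z i.+1) (z i) zi'.
    by move=> c _; apply: hd.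
  exists c => _; split; first by apply/andP; split; apply/RltP.
  rewrite !h0 // in Ec; last exact: ltnW.
  move: Ec; rewrite !RminusE RmultE subrr => /esym/eqP; rewrite mulf_eq0.
  by rewrite subr_eq0 (gt_eqF zi) orbF => /eqP.
apply: (IH (fun j => h j.+1) c).
- apply: sdec_step => i ik; have [/andP[h1 _] _] := cP i (ltnW ik).
  by have [/andP[_ h2] _] := cP i.+1 ik; apply: lt_trans h1.
- by move=> j jk t; apply: hd.
- by move=> i ik; have [] := cP i ik.
Qed.

Lemma derivable_pt_lim_horner (p : {poly R}) t :
  derivable_pt_lim (fun u => p.[u]) t (p^`()).[t].
Proof.
elim/poly_ind: p => [|p c IH].
  rewrite deriv0 horner0.
  apply: (derivable_pt_lim_ext (fun=> 0)); last exact: derivable_pt_lim_const.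
  by move=> u; rewrite horner0.
rewrite derivD derivM derivX derivC addr0 mulr1 !hornerE.
apply: (derivable_pt_lim_ext (fun u => Rplus (Rmult p.[u] u) c)).
  by move=> u; rewrite !hornerE.
have -> : p^`().[t] * t + p.[t] = Rplus (Rplus (Rmult p^`().[t] t) (Rmult p.[t] 1)) 0.
  by rewrite !RplusE !RmultE mulr1 addr0.
apply: derivable_pt_lim_plus; last exact: derivable_pt_lim_const.
exact: (derivable_pt_lim_mult _ _ _ _ _ IH (derivable_pt_lim_id t)).
Qed.

Lemma derivn_rpoly (F : rcfType) k (z : nat -> F) : (rpoly k z)^`(k) = k`!%:R%:P.
Proof.
apply/polyP => i; rewrite coef_derivn coefC; case: eqP => [->|/eqP i0].
  by rewrite addn0 coef_rpoly ffactnn.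
by rewrite nth_default ?mul0rn // size_rpoly -addn1 leq_add2l lt0n.
Qed.

Lemma derivn_small (F : rcfType) k (p : {poly F}) : (size p <= k)%N -> p^`(k) = 0.
Proof.
move=> sp; apply/polyP => i; rewrite coef_derivn coef0 nth_default ?mul0rn //.
exact: leq_trans sp (leq_addr _ _).
Qed.

(** The classical error formula: [w] makes [q] agree with [f] at [t] as well as at the [k] nodes, so
    the k-th derivative of [f - q] vanishes at some [u], and [w] is [g k u] divided by k!. *)
Lemma k_diff_kconvex k f : k_diff_nonneg k f -> kconvex k f.
Proof.
move=> [g [g0 [gd gk]]] z zs; have [p sp pv] := interpolation (fun i => f (z i)) zs.
exists p => // t; have [zt|nzt] := pselect (exists2 i, (i < k)%N & t = z i).
  by case: zt => i ik ->; exists 0; rewrite // mul0r addr0 pv.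
have S0 : (rpoly k z).[t] != 0 by apply/eqP => /root_rpoly.
pose w := (f t - p.[t]) / (rpoly k z).[t].
exists w; last by rewrite /w divfK // addrC subrK.
pose q := p + w *: rpoly k z.
pose h j u := g j u - (q^`(j)).[u].
pose v i := if i is i'.+1 then z i' else t.
have [|y [ys yv]] := @sort_distinct _ k.+1 v.
  move=> [|i] [|j] //=; rewrite ?ltnS => ik jk.
  - by move=> tz; case: nzt; exists j.
  - by move=> tz; case: nzt; exists i.
  - move=> zij; case: (ltngtP i j) => [ij|ji|->//].
      by have := zs _ _ ij jk; rewrite zij ltxx.
    by have := zs _ _ ji ik; rewrite zij ltxx.
have [||u hu] := @rolle_chain k h y ys.
- move=> j jk u; rewrite /h derivnS; apply: derivable_pt_lim_minus.
    by apply: gd; apply/ssrnat.ltP.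
  exact: derivable_pt_lim_horner.
- move=> i ik; have [j jk ->] := yv i ik.
  rewrite /h derivn0 g0 /q hornerD hornerZ; case: j jk => [|j] jk /=.
    by rewrite /w divfK //; ring.
  by rewrite horner_rpoly_root // mulr0 addr0 pv // subrr.
move: hu; rewrite /h /q derivnD derivnZ derivn_small // add0r derivn_rpoly.
rewrite hornerZ hornerC => /eqP; rewrite subr_eq0 => /eqP E.
have f0 : 0 < k`!%:R :> R by rewrite ltr0n fact_gt0.
by rewrite -(pmulr_lge0 _ f0) -E; apply/RleP; exact: gk.
Qed.

Lemma k_diff_continuous k f : (0 < k)%N -> k_diff_nonneg k f -> continuous f.
Proof.
move=> k0 [g [g0 [gd _]]] t; apply/continuity_ptE.
have -> : f = g 0%N by apply/funext => u; rewrite g0.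
apply: derivable_continuous_pt; exists (g 1%N t); apply: gd; exact/ssrnat.ltP.
Qed.

Lemma derivable_pt_lim_exp_scale (c m t : R) :
  derivable_pt_lim (fun u => c * exp (m * u)%R) t (c * m * exp (m * t)%R).
Proof.
have -> : c * m * exp (m * t)%R = Rmult c (Rmult (exp (Rmult m t)) (Rmult m 1)).
  by rewrite !RmultE mulr1; ring.
apply: (derivable_pt_lim_scal (fun u => exp (Rmult m u)%R)).
apply: (derivable_pt_lim_comp (fun u => Rmult m u) exp).
  exact: (derivable_pt_lim_scal id m t 1 (derivable_pt_lim_id t)).
exact: derivable_pt_lim_exp.
Qed.

Lemma k_diff_exp k (c m : R) : 0 <= c * m ^+ k ->
  k_diff_nonneg k (fun t => c * exp (m * t)%R).
Proof.
move=> cm; exists (fun j t => c * m ^+ j * exp (m * t)%R); split; last split.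
- by move=> t; rewrite expr0 mulr1.
- by move=> j _ t; rewrite exprSr mulrA; apply: derivable_pt_lim_exp_scale.
- move=> t; apply/RleP; apply: mulr_ge0 => //; apply/RleP; left; exact: exp_pos.
Qed.

Lemma exp_dominated (N u v : R) :
  (forall l, 0 < l -> exp (l * u)%R <= N * exp (l * v)%R) -> u <= v.
Proof.
move=> H; rewrite leNgt; apply/negP => vu.
have exp_gt0 w : 0 < exp w by apply/RltP; exact: exp_pos.
have N0 : 0 < N by have := H 1 ltr01; rewrite -(pmulr_lgt0 _ (exp_gt0 (1 * v))); apply: lt_le_trans.
have d0 : 0 < u - v by rewrite subr_gt0.
(* This [l] turns the hypothesis into exp N <= N, against 1 + N < exp N. *)
pose l := N / (u - v).
have l0 : 0 < l by exact: divr_gt0.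
have := H l l0; have -> : l * u = l * v + N.
  by rewrite -[N](divfK (lt0r_neq0 d0)) -/l; ring.
have -> : exp (l * v + N)%R = exp N * exp (l * v)%R by rewrite -Rstruct.expRD mulrC.
rewrite ler_pM2r // leNgt => /negP; apply.
have /RltP : Rlt (Rplus (IZR 1) N) (exp N).
  by apply: exp_ineq1; apply/eqP; rewrite gt_eqF.
by rewrite RplusE; apply: lt_trans; rewrite ltrDr ltr01.
Qed.

(** * Translation of the definitions of the statement, and test functions *)

Lemma rsumE n (F : nat -> R) : rsum n F = \sum_(i < n) F i.
Proof. by elim: n => [|n IH] /=; rewrite ?big_ord0 // big_ord_recr /= IH. Qed.

Lemma kmajE k a b : kmaj k k.+1 a b <-> maj k (k_diff_nonneg k) a b.
Proof.
split=> H f /H; rewrite !rsumE; first by move=> /Rge_le/RleP.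
by move=> /RleP/Rle_ge.
Qed.

(* The exponentials exp (l t) and (-1)^k exp (- l t), l > 0, are admissible test
   functions and detect the largest and the smallest coordinate as l grows. *)
Lemma kmaj_ends k a b : dec k.+1 a -> dec k.+1 b ->
  maj k (k_diff_nonneg k) a b -> ends_le k b a.
Proof.
move=> ad bd ab.
have exp_ge0 w : 0 <= exp w by apply/RleP; left; exact: exp_pos.
have expM w w' : w <= w' -> exp w <= exp w'.
  rewrite le_eqVlt => /predU1P[->//|/RltP ww']; apply/RleP; left; exact: exp_increasing.
have lb (z : nat -> R) (g : R -> R) i : (forall t, 0 <= g t) -> (i < k.+1)%N ->
    g (z i) <= \sum_(j < k.+1) g (z j).
  move=> g0 ik; rewrite (bigD1 (Ordinal ik)) //= lerDl; exact: sumr_ge0.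
have ub (z : nat -> R) (g : R -> R) i : (forall j, (j < k.+1)%N -> g (z j) <= g (z i)) ->
    \sum_(j < k.+1) g (z j) <= k.+1%:R * g (z i).
  move=> gz; apply: (@le_trans _ _ (\sum_(j < k.+1) g (z i))).
    by apply: ler_sum => j _; apply: gz.
  by rewrite sumr_const card_ord mulr_natl.
have expand (c m : R) : 0 <= c * m ^+ k ->
    c * \sum_(j < k.+1) exp (m * b j)%R <= c * \sum_(j < k.+1) exp (m * a j)%R.
  by move=> cm; have := ab _ (k_diff_exp cm); rewrite -!big_distrr.
split.
  apply: (@exp_dominated k.+1%:R) => l l0.
  have := @expand 1 l; rewrite !mul1r (exprn_ge0 _ (ltW l0)) => /(_ isT) h.
  apply: le_trans (lb b (fun t => exp (l * t)%R) 0%N _ isT) _; first by [].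
  apply: le_trans h _; apply: (ub a (fun t => exp (l * t)%R)) => j jk.
  by apply: expM; rewrite ler_pM2l //; apply: ad.
(* Two arbitrary points, since the parity of [k] decides which of them is [a] and which is [b]. *)
have main (x y : nat -> R) : dec k.+1 x -> dec k.+1 y ->
    (forall l, 0 < l -> \sum_(j < k.+1) exp (- l * x j)%R <= \sum_(j < k.+1) exp (- l * y j)%R) ->
    y k <= x k.
  move=> xd yd H; rewrite -lerN2; apply: (@exp_dominated k.+1%:R) => l l0.
  rewrite !mulrN -!mulNr.
  apply: le_trans (lb x (fun t => exp (- l * t)%R) k _ (ltnSn k)) _; first by [].
  apply: le_trans (H l l0) _; apply: (ub y (fun t => exp (- l * t)%R)) => j jk.
  by apply: expM; rewrite !mulNr lerN2 ler_pM2l //; apply: yd.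
have cl l : 0 < l -> 0 <= (-1) ^+ k * (- l) ^+ k :> R.
  by move=> l0; rewrite -exprMn mulN1r opprK exprn_ge0 // ltW.
case: (boolP (odd k)) => ok.
  rewrite even_signr /= ?ok // !mul1r; apply: main => // l l0.
  by have := expand _ _ (cl l l0); rewrite odd_signr // !mulN1r lerN2.
rewrite odd_signr // !mulN1r lerN2; apply: main => // l l0.
by have := expand _ _ (cl l l0); rewrite even_signr // !mul1r.
Qed.

Lemma in_SE k s x : in_S k k.+1 s x <-> fibre k s x.
Proof.
split=> -[xd xs]; split.
- apply: dec_step => i lin; apply/RleP; rewrite -addn1; apply: xd.
  by apply/ssrnat.ltP; rewrite plusE addn1.
- move=> j j0 jk; have <- : rsum k.+1 (fun i => pow (x i) j) = s j.
    by apply: xs; apply/ssrnat.leP => //; rewrite minusE; lia.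
  by rewrite rsumE; apply: eq_bigr => i _; rewrite RpowE.
- move=> i /ssrnat.ltP; rewrite plusE addn1 => lin; apply/RleP; exact: xd.
- move=> j /ssrnat.leP j0 /ssrnat.leP; rewrite minusE => jk; rewrite -xs //; last by lia.
  by rewrite rsumE; apply: eq_bigr => i _; rewrite RpowE.
Qed.

Lemma in_01E (t : R) : Rle (IZR 0) t /\ Rle t (IZR 1) <-> 0 <= t <= 1.
Proof. by split=> [[/RleP h1 /RleP h2]|/andP[/RleP h1 /RleP h2]] //; apply/andP. Qed.

Lemma kmaj_path (k : nat) (s a b : nat -> R) : (3 <= k)%coq_nat ->
  in_S k (k + 1)%coq_nat s a -> in_S k (k + 1)%coq_nat s b ->
  kmaj k (k + 1)%coq_nat a b ->
  exists p : R -> nat -> R,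
    (forall t, (0 <= t <= 1)%coqR -> in_S k (k + 1)%coq_nat s (p t)) /\
    (forall i, (i < k + 1)%coq_nat -> cont_on_01 (fun t => p t i)) /\
    (forall i, (i < k + 1)%coq_nat -> p (IZR 0) i = b i) /\
    (forall i, (i < k + 1)%coq_nat -> p (IZR 1) i = a i) /\
    (forall t0 t1, (0 <= t0 <= 1)%coqR -> (0 <= t1 <= 1)%coqR -> (t0 <= t1)%coqR ->
       kmaj k (k + 1)%coq_nat (p t1) (p t0)).
Proof.
rewrite plusE addn1 => /ssrnat.leP k3 /in_SE aS /in_SE bS ab.
have k0 : (0 < k)%N by exact: leq_trans k3.
have ba : ends_le k b a by apply: kmaj_ends; [case: aS|case: bS|exact/kmajE].
have lba : lam k b <= lam k a.
  (* The k-th derivative of t^k is the constant k!, so majorization orders the k-th power sums. *)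
  have : k_diff_nonneg k (fun t => t ^+ k).
    exists (fun j t => (('X^k : {poly R})^`(j)).[t]); split; last split.
    - by move=> t; rewrite derivn0 hornerXn.
    - by move=> j _ t; rewrite derivnS; apply: derivable_pt_lim_horner.
    - move=> t; apply/RleP; rewrite derivnXn subnn expr0 ffactnn hornerMn hornerC.
      exact: ler0n.
  by move/((kmajE k a b).1 ab).
have [p [p1 p2 p3 p4 p5]] := @monotone_path _ k s _ k3 (@k_diff_kconvex k)
  (fun f => @k_diff_continuous k f k0) (@kmaj_ends k) _ _ bS aS ba lba.
exists p; split; last split; last split; last split.
- by move=> t /in_01E t01; apply/in_SE; apply: p1.
- move=> i /ssrnat.ltP ik t /in_01E t01 e /RltP e0.
  have [d /RltP d0 dP] := p2 i ik t t01 e e0.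
  exists d; split => // t' /in_01E t'01 /RltP; rewrite RabsE RminusE => h.
  by apply/RltP; rewrite RabsE RminusE; apply: dP.
- by move=> i /ssrnat.ltP; apply: p3.
- by move=> i /ssrnat.ltP; apply: p4.
- move=> t0 t1 /in_01E h0 /in_01E h1 /RleP h; apply/kmajE; exact: p5.
Qed.

End MonotonePath.

Open Scope R_scope.

Theorem mainTheorem17 (k : nat) (s : nat -> R) (a b : nat -> R) :
  (3 <= k)%nat ->
  in_S k (k + 1) s a -> in_S k (k + 1) s b ->
  kmaj k (k + 1) a b ->
  exists p : R -> nat -> R,
    (forall t, 0 <= t <= 1 -> in_S k (k + 1) s (p t)) /\
    (forall i : nat, (i < k + 1)%nat -> cont_on_01 (fun t => p t i)) /\
    (forall i : nat, (i < k + 1)%nat -> p 0 i = b i) /\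
    (forall i : nat, (i < k + 1)%nat -> p 1 i = a i) /\
    (forall t0 t1, 0 <= t0 <= 1 -> 0 <= t1 <= 1 -> t0 <= t1 ->
       kmaj k (k + 1) (p t1) (p t0)).
Proof. exact (@MonotonePath.kmaj_path k s a b). Qed.
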